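(* Let $V$ be a real operator system. The following are equivalent: (a) $V$ is a complex operator system (that is, there is a complex scalar multiplication on $V$, extending the real one, making $V$ a complex operator system with the given underlying real operator system structure); (b) $V$ possesses a real operator system centralizer $z$ with $z^2=-1$; (c) $V$ is real linearly completely isometric to a complex operator space.
   Context: A real (resp. complex) operator system is a unital selfadjoint real (resp. complex) subspace of $B(H)$ for a real (resp. complex) Hilbert space $H$, considered up to unital complete order isomorphism (equivalently, unital surjective complete isometry). A complex operator system (or operator space) is regarded as a real one by forgetting multiplication by $i$. Let $(I(V),j)$ be the real injective envelope of $V$: $I(V)$ is an injective real operator system which may be taken to be a unital real C$^*$-algebra, and $j:V\to I(V)$ is a unital complete order embedding such that the only unital completely positive map $I(V)\to I(V)$ restricting to the identity on $j(V)$ is the identity. Let $Z$ be the $*$-subalgebra of all $w\in I(V)$ such that $w\,j(V)\subseteq j(V)$, $w^*j(V)\subseteq j(V)$, and $w\,j(x)=j(x)\,w$ for all $x\in V$. A (real operator system) centralizer of $V$ is a linear map $z:V\to V$ for which there is $w\in Z$ with $j(z(x))=w\,j(x)$ for all $x\in V$; $z^2=-1$ means $z\circ z=-{\rm id}_V$. *)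

(* Defs.v *)
From HB Require Import structures.
From mathcomp Require Import all_boot all_order all_algebra sesquilinear.
From mathcomp Require Import all_classical all_reals.
From mathcomp Require Import topology normedtype.
From mathcomp Require Import complex.

Set Implicit Arguments.
Unset Strict Implicit.
Unset Printing Implicit Defensive.

Import Order.TTheory GRing.Theory Num.Theory.
Import numFieldNormedType.Exports.

Local Open Scope classical_set_scope.
Local Open Scope ring_scope.
Local Open Scope complex_scope.

(* [theta] is the conjugation of the scalar field [K]; the two cases in use are
   [idfun] on a [realType] [R] and [conjc] on [R[i]].  Following sesquilinear.v,
   inner products are linear in their first argument. *)

Section OperatorSpaces.
Variables (K : numFieldType) (theta : K -> K).

Record hilbert := Hilbert {
  hspace :> completeNormedModType K;
  hdot : {dot hspace for theta};
  hdotE : forall x : hspace, hdot x x = `|x| ^+ 2 }.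

(* A linear subspace of B(H), not required to be norm closed, is presented as
   an abstract vector space with a faithful linear map [oprep] into B(H):
   [oprep v] is the bounded operator on H denoted by [v]. *)
Record opspace := OpSpace {
  opcar :> lmodType K;
  ophil : hilbert;
  oprep : {bilinear opcar -> ophil -> ophil};
  oprep_continuous : forall v, continuous (oprep v);
  oprep_faithful : forall v, (forall h, oprep v h = 0) -> v = 0 }.

Arguments oprep {_}.

(* [opone] and [opstar] are determined by [oprep]; they express that the
   subspace contains the identity and is closed under adjoints. *)
Record opsys := OpSys {
  opsys_space :> opspace;
  opone : opsys_space;
  opstar : opsys_space -> opsys_space;
  oponeE : forall h, oprep opone h = h;
  opstarE : forall v x y,
    hdot _ (oprep v x) y = hdot _ x (oprep (opstar v) y) }.

End OperatorSpaces.

Arguments hdot {K theta} h.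
Arguments oprep {K theta o}.
Arguments opone {K theta o}.
Arguments opstar {K theta o}.

(* Restriction of scalars from [R[i]] to [R]. *)
Definition realify (T : Type) : Type := T.

Section RealifyLmodule.
Variables (R : realType) (V : lmodType R[i]).

HB.instance Definition _ := GRing.Zmodule.copy (realify V) V.

Definition realify_scale (r : R) (v : realify V) : realify V :=
  r%:C *: (v : V).

Lemma realify_scaleA a b v :
  realify_scale a (realify_scale b v) = realify_scale (a * b) v.
Proof. by rewrite /realify_scale scalerA -rmorphM. Qed.

Lemma realify_scale1 : left_id 1 realify_scale.
Proof. by move=> v; rewrite /realify_scale rmorph1 scale1r. Qed.

Lemma realify_scaleDr : right_distributive realify_scale +%R.
Proof. by move=> a u v; rewrite /realify_scale scalerDr. Qed.

Lemma realify_scaleDl v : {morph realify_scale^~ v : a b / a + b}.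
Proof. by move=> a b; rewrite /realify_scale rmorphD scalerDl. Qed.

HB.instance Definition _ := GRing.Zmodule_isLmodule.Build R (realify V)
  realify_scaleA realify_scale1 realify_scaleDr realify_scaleDl.

Lemma realify_scaleE (r : R) (v : V) :
  r *: (v : realify V) = (r%:C *: v : V).
Proof. by []. Qed.

End RealifyLmodule.

Section RealifyNormed.
Variables (R : realType) (V : completeNormedModType R[i]).
Local Notation W := (realify V).

Let ReK (v : V) : (complex.Re (`|v| : R[i]))%:C = `|v| :> R[i].
Proof. by rewrite RRe_real// normr_real. Qed.

Definition realify_norm (v : W) : R := complex.Re (`|v : V| : R[i]).

Let realify_normD (x y : W) :
  realify_norm (x + y) <= realify_norm x + realify_norm y.
Proof. by rewrite -lecR rmorphD /= !ReK ler_normD. Qed.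

Let realify_norm0 (x : W) : realify_norm x = 0 -> x = 0.
Proof.
by move=> x0; apply/eqP; rewrite -(@normr_eq0 _ V) -ReK -/(realify_norm x) x0.
Qed.

Let realify_normMn (x : W) n : realify_norm (x *+ n) = realify_norm x *+ n.
Proof. by rewrite /realify_norm normrMn raddfMn. Qed.

Let realify_normN (x : W) : realify_norm (- x) = realify_norm x.
Proof. by rewrite /realify_norm normrN. Qed.

HB.instance Definition _ := Num.Zmodule_isNormed.Build R W
  realify_normD realify_norm0 realify_normMn realify_normN.

Lemma realify_normE (v : V) : `|v : W| = complex.Re (`|v| : R[i]).
Proof. by []. Qed.

HB.instance Definition _ := Complete.copy W V.

Let realify_ball (x : W) (e : R) : set W := ball_ Num.norm x e.

Let realify_ball_center (x : W) (e : R) : 0 < e -> realify_ball x e x.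
Proof. by move=> e0; rewrite /realify_ball /= subrr normr0. Qed.

Let realify_ball_sym (x y : W) (e : R) :
  realify_ball x e y -> realify_ball y e x.
Proof. by rewrite /realify_ball /= distrC. Qed.

Let realify_ball_triangle (x y z : W) (e1 e2 : R) :
  realify_ball x e1 y -> realify_ball y e2 z -> realify_ball x (e1 + e2) z.
Proof.
rewrite /realify_ball /= => xy yz; rewrite -(subrKA y).
by rewrite (le_lt_trans (ler_normD _ _))// ltrD.
Qed.

Let realify_entourageE : @entourage W = entourage_ realify_ball.
Proof.
have ballE (x y : V) (e : R) : `|x - y| < e%:C <-> realify_ball x e y.
  by rewrite -ReK ltcR.
rewrite -[LHS](@entourage_ballE _ V); apply/seteqP; split=> A /= [e e0 eA].
  have er : (complex.Re e)%:C = e by rewrite RRe_real// gtr0_real.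
  exists (complex.Re e); first by rewrite /= -ltcR er.
  by move=> xy /ballE; rewrite er => xye; apply: eA; rewrite -ball_normE.
exists e%:C; first by rewrite /= ltcR.
by move=> xy; rewrite -ball_normE => /ballE xye; apply: eA.
Qed.

HB.instance Definition _ := Uniform_isPseudoMetric.Build R W
  realify_ball_center realify_ball_sym realify_ball_triangle
  realify_entourageE.

HB.instance Definition _ := NormedZmod_PseudoMetric_eq.Build R W erefl.

Let realify_normrZ (r : R) (x : W) : `|r *: x| = `|r| * `|x|.
Proof.
rewrite !realify_normE realify_scaleE normrZ normc_def /= expr0n addr0 sqrtr_sqr.
by case: (`|x : V| : R[i]) => a b /=; rewrite mul0r subr0.
Qed.

HB.instance Definition _ :=
  PseudoMetricNormedZmod_Lmodule_isNormedModule.Build R W realify_normrZ.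

End RealifyNormed.

Section RealifyOpsys.
Variable R : realType.
Local Notation conj := (@conjc R).

Section RealifyHilbert.
Variable H : hilbert conj.

Definition realify_dot (x y : realify H) : R := complex.Re (hdot H x y).

Let realify_dotC x y : realify_dot x y = realify_dot y x.
Proof. by rewrite /realify_dot hermC expr0 mul1r /=; case: (hdot H y x : R[i]). Qed.

Let realify_dot_linearl y : linear_for *%R (realify_dot^~ y).
Proof.
move=> a u v; rewrite /realify_dot realify_scaleE linearPl /=.
by case: (hdot H u y) (hdot H v y) => [b c] [d e] /=; rewrite mul0r subr0.
Qed.

Let realify_dot_bilinear :
  bilinear_for ( *%R : R -> R -> R) (idfun \; *%R) realify_dot.
Proof.
split=> [y|x]; first exact: realify_dot_linearl.
move=> a u v /=; rewrite ![realify_dot x _]realify_dotC.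
exact: realify_dot_linearl.
Qed.

HB.instance Definition _ :=
  bilinear_isBilinear.Build R (realify H) (realify H) R _ _ realify_dot
    realify_dot_bilinear.

Let realify_dot_sym x y :
  realify_dot x y = (-1) ^+ false * idfun (realify_dot y x).
Proof. by rewrite expr0 mul1r realify_dotC. Qed.

HB.instance Definition _ :=
  isHermitianSesquilinear.Build R (realify H) false idfun realify_dot
    realify_dot_sym.

Let realify_dot_gt0 (x : realify H) : x != 0 -> 0 < realify_dot x x.
Proof.
move=> x0; have := @neq0_dnorm_gt0 _ _ _ (hdot H) x x0.
by rewrite /realify_dot ltcE => /andP[].
Qed.

HB.instance Definition _ :=
  isDotProduct.Build R (realify H) realify_dot realify_dot_gt0.

Let realify_dotE (x : realify H) : realify_dot x x = `|x| ^+ 2.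
Proof.
rewrite realify_normE /realify_dot hdotE.
have <- : (complex.Re (`|x : H| : R[i]))%:C = `|x : H| :> R[i].
  by rewrite RRe_real// normr_real.
by rewrite -rmorphXn.
Qed.

Definition realify_hilbert : hilbert (idfun : R -> R) :=
  @Hilbert R idfun (realify H) realify_dot realify_dotE.

End RealifyHilbert.

Section RealifyOpspace.
Variable X : opspace conj.

Definition realify_rep (v : realify X) (h : realify (ophil X)) :
  realify (ophil X) := oprep v h.

Let realify_rep_bilinear :
  bilinear_for ( *:%R : R -> realify (ophil X) -> _) *:%R realify_rep.
Proof.
split=> [h a u v|x a u v].
  by rewrite /realify_rep realify_scaleE linearPl.
by rewrite /realify_rep realify_scaleE linearPr.
Qed.

HB.instance Definition _ :=
  bilinear_isBilinear.Build R (realify X) (realify (ophil X))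
    (realify (ophil X)) _ _ realify_rep realify_rep_bilinear.

Definition realify_opspace : opspace (idfun : R -> R) :=
  @OpSpace R idfun (realify X) (realify_hilbert (ophil X)) realify_rep
    (@oprep_continuous _ _ X) (@oprep_faithful _ _ X).

End RealifyOpspace.

Section RealifyOpsys.
Variable V : opsys conj.

Let realify_opstarE (v : realify V) (x y : realify (ophil V)) :
  realify_dot (realify_rep v x) y = realify_dot x (realify_rep (opstar v) y).
Proof. by rewrite /realify_dot /realify_rep opstarE. Qed.

Definition realify_opsys : opsys (idfun : R -> R) :=
  @OpSys R idfun (realify_opspace V) (opone : V) (opstar : V -> V)
    (@oponeE _ _ V) realify_opstarE.

End RealifyOpsys.
End RealifyOpsys.

Notation ropspace R := (opspace (idfun : R -> R)).
Notation ropsys R := (opsys (idfun : R -> R)).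
Notation copspace R := (opspace (@conjc R)).
Notation copsys R := (opsys (@conjc R)).

Section RealOpspace.
Variable R : realType.

(* The operator on H^n = H (+) ... (+) H given by a matrix over X. *)
Definition mxrep (X : ropspace R) n (x : 'M[X]_n) (h : 'I_n -> ophil X)
    (i : 'I_n) : ophil X :=
  \sum_j oprep (x i j) (h j).

Definition hnorm2 (H : hilbert (idfun : R -> R)) n (h : 'I_n -> H) : R :=
  Num.sqrt (\sum_i `|h i| ^+ 2).

(* The norm of M_n(X), i.e. the operator norm on H^n. *)
Definition mxnorm (X : ropspace R) n (x : 'M[X]_n) : R :=
  sup [set hnorm2 (mxrep x h) | h in [set h | hnorm2 h <= 1]].

Definition complete_isometry (X Y : ropspace R) (f : X -> Y) :=
  forall n (x : 'M[X]_n), mxnorm (map_mx f x) = mxnorm x.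

(* The positive cone of M_n(V).  Over the reals selfadjointness is not implied
   by nonnegativity of the quadratic form. *)
Definition mxpos (V : ropsys R) n (x : 'M[V]_n) : Prop :=
  (forall i j, opstar (x i j) = x j i) /\
  (forall h : 'I_n -> ophil V, 0 <= \sum_i hdot (ophil V) (mxrep x h i) (h i)).

Definition ucp (V W : ropsys R) (f : {linear V -> W}) : Prop :=
  f opone = opone /\ forall n (x : 'M[V]_n), mxpos x -> mxpos (map_mx f x).

Definition unital_complete_order_embedding (V W : ropsys R)
    (f : {linear V -> W}) : Prop :=
  [/\ injective f, f opone = opone &
      forall n (x : 'M[V]_n), mxpos (map_mx f x) <-> mxpos x].

Definition injective_opsys (I : ropsys R) : Prop :=
  forall (E F : ropsys R) (i : {linear E -> F}) (f : {linear E -> I}),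
    unital_complete_order_embedding i -> ucp f ->
    exists2 g : {linear F -> I}, ucp g & forall x, g (i x) = f x.

(* A unital real C*-algebra: an operator system in B(H) which is a subalgebra
   of B(H) closed in the operator norm. *)
Record rcstar := RCstar {
  rcstar_opsys :> ropsys R;
  cmul : rcstar_opsys -> rcstar_opsys -> rcstar_opsys;
  cmulE : forall a b h, oprep (cmul a b) h = oprep a (oprep b h);
  rcstar_closed : forall (u : nat -> rcstar_opsys)
      (T : {linear ophil rcstar_opsys -> ophil rcstar_opsys}),
    (forall e : R, 0 < e ->
       \forall n \near \oo, forall h, `|oprep (u n) h - T h| <= e * `|h|) ->
    exists v, forall h, oprep v h = T h }.

Definition injective_envelope (V : ropsys R) (I : rcstar)
    (j : {linear V -> I}) : Prop :=
  [/\ injective_opsys I, unital_complete_order_embedding j &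
      forall f : {linear I -> I},
        ucp f -> (forall x, f (j x) = j x) -> forall a, f a = a].

Definition centralizer_alg (V : ropsys R) (I : rcstar) (j : {linear V -> I}) :
    set I :=
  [set w | [/\ forall x, range j (cmul w (j x)),
               forall x, range j (cmul (opstar w) (j x)) &
               forall x, cmul w (j x) = cmul (j x) w]].

Definition centralizer (V : ropsys R) (I : rcstar) (j : {linear V -> I})
    (z : {linear V -> V}) : Prop :=
  exists2 w, centralizer_alg j w & forall x, j (z x) = cmul w (j x).

(* [s] is a complex vector space structure on [V] extending the real one; the
   unit law is the case [r = 1] of [cscale_real]. *)
Record complex_scaling (V : lmodType R) (s : R[i] -> V -> V) : Prop := {
  cscaleA : forall a b v, s a (s b v) = s (a * b) v;
  cscaleDr : forall a u v, s a (u + v) = s a u + s a v;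
  cscaleDl : forall a b v, s (a + b) v = s a v + s b v;
  cscale_real : forall (r : R) v, s r%:C v = r *: v }.

Definition is_complex_opsys (V : ropsys R) : Prop :=
  exists2 s : R[i] -> V -> V, complex_scaling s &
  exists (W : copsys R) (f : {linear V -> realify_opsys W}),
    [/\ bijective f, unital_complete_order_embedding f &
        forall c v, f (s c v) = c *: (f v : W)].

Definition cisometric_to_complex_opspace (V : ropsys R) : Prop :=
  exists (X : copspace R) (f : {linear V -> realify_opspace X}),
    bijective f /\ complete_isometry f.

End RealOpspace.

(* Main.v *)
(* [centralizer -> complex] If [w] implements [z] then [w] is a normal element
   of [j(V)] with [w^2 = -1], hence a skew-adjoint isometry.  It turns the Hilbert
   space of [I(V)] into a complex one, on which [j(V)] acts complex linearly.

   [complex operator space -> centralizer] Let [u] be multiplication by [i],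
   transported to [V].  It does not increase the norm of columns [x; y] when
   applied to [x] only.  Hence [(x, y) |-> (u x, y)] induces a ucp map on the
   Paulsen-type system of matrices
       [ l 0  x ]
       [ 0 m  y ]      (l, m scalars; x, y, x', y' in V)
       [ x' y' m ]
   inside [M_3(I(V))], and injectivity of [I(V)] extends it to [M_3(I(V))].  By
   rigidity the extension is the identity on the entries (2, 2), (2, 3), (3, 3),
   and a Cauchy-Schwarz argument for the Stinespring form makes it multiplicative
   there, so that [j(u x) = a j(x)] with [a] the image of the matrix unit
   [E_12].  The same argument with rows gives [j(u x) = j(x) a].

   [complex operator system -> complex operator space] A unital complete order
   embedding is completely isometric, as [|x| <= c] iff
   [[c x; x* c]] is positive. *)
Require Import Defs.
From HB Require Import structures.
From mathcomp Require Import all_boot all_order all_algebra sesquilinear.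
From mathcomp Require Import all_classical all_reals.
From mathcomp Require Import topology normedtype.
From mathcomp Require Import complex ring lra.

Set Implicit Arguments.
Unset Strict Implicit.
Unset Printing Implicit Defensive.

Import Order.TTheory GRing.Theory Num.Theory.
Import numFieldNormedType.Exports.

Local Open Scope classical_set_scope.
Local Open Scope ring_scope.
Local Open Scope complex_scope.

(** * Hilbert spaces and matrices over a real operator system *)

Local Notation "<< x , y >>" := (hdot _ x y) 
  (at level 0, format "<< x ,  y >>") : ring_scope.

Section RealHilbert.
Variables (R : realType) (H : hilbert (idfun : R -> R)).
Implicit Types (x y z : H) (a : R).

Lemma dotC x y : <<x, y>> = <<y, x>> :> R.
Proof. by rewrite hermC expr0 mul1r. Qed.

Lemma dotDl x y z : <<x + y, z>> = <<x, z>> + <<y, z>> :> R.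
Proof. exact: linearDl. Qed.

Lemma dotDr x y z : <<z, x + y>> = <<z, x>> + <<z, y>> :> R.
Proof. exact: linearDr. Qed.

Lemma dotNl x y : <<- x, y>> = - <<x, y>> :> R.
Proof. exact: linearNl. Qed.

Lemma dotNr x y : <<y, - x>> = - <<y, x>> :> R.
Proof. exact: linearNr. Qed.

Lemma dotBl x y z : <<x - y, z>> = <<x, z>> - <<y, z>> :> R.
Proof. exact: linearBl. Qed.

Lemma dotBr x y z : <<z, x - y>> = <<z, x>> - <<z, y>> :> R.
Proof. exact: linearBr. Qed.

Lemma dotZl a x y : <<a *: x, y>> = a * <<x, y>> :> R.
Proof. exact: linearZl_LR. Qed.

Lemma dotZr a x y : <<y, a *: x>> = a * <<y, x>> :> R.
Proof. exact: linearZr_LR. Qed.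

Lemma dot0l y : <<0, y>> = 0 :> R.
Proof. exact: linear0l. Qed.

Lemma dot0r y : <<y, 0>> = 0 :> R.
Proof. exact: linear0r. Qed.

Lemma dot_suml (I : finType) (f : I -> H) y :
  <<\sum_i f i, y>> = \sum_i <<f i, y>> :> R.
Proof. exact: linear_sumlz. Qed.

Lemma dot_sumr (I : finType) (f : I -> H) y :
  <<y, \sum_i f i>> = \sum_i <<y, f i>> :> R.
Proof. exact: linear_sumr. Qed.

Lemma dotxx_ge0 x : 0 <= <<x, x>> :> R.
Proof. by rewrite hdotE sqr_ge0. Qed.

Lemma dotxx_eq0 x : <<x, x>> = 0 :> R -> x = 0.
Proof. by rewrite hdotE => /eqP; rewrite sqrf_eq0 normr_eq0 => /eqP. Qed.

Lemma dot_ext x y : (forall z, <<x, z>> = <<y, z>> :> R) -> x = y.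
Proof.
move=> xy; apply/eqP; rewrite -subr_eq0; apply/eqP/dotxx_eq0.
by rewrite dotBl xy subrr.
Qed.

End RealHilbert.

Section RealOpsys.
Variables (R : realType) (V : ropsys R).
Implicit Types (v w : V) (h k : ophil V) (a : R).

Lemma oprepDl v w h : oprep (v + w) h = oprep v h + oprep w h.
Proof. exact: linearDl. Qed.
Lemma oprepBl v w h : oprep (v - w) h = oprep v h - oprep w h.
Proof. exact: linearBl. Qed.
Lemma oprepNl v h : oprep (- v) h = - oprep v h.
Proof. exact: linearNl. Qed.
Lemma oprepZl a v h : oprep (a *: v) h = a *: oprep v h.
Proof. exact: linearZl_LR. Qed.
Lemma oprep0l h : oprep (0 : V) h = 0.
Proof. exact: linear0l. Qed.
Lemma oprepDr v h k : oprep v (h + k) = oprep v h + oprep v k.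
Proof. exact: linearDr. Qed.
Lemma oprepNr v h : oprep v (- h) = - oprep v h.
Proof. exact: linearNr. Qed.
Lemma oprepBr v h k : oprep v (h - k) = oprep v h - oprep v k.
Proof. exact: linearBr. Qed.
Lemma oprepZr a v h : oprep v (a *: h) = a *: oprep v h.
Proof. exact: linearZr_LR. Qed.
Lemma oprep0r v : oprep v (0 : ophil V) = 0.
Proof. exact: linear0r. Qed.
Lemma oprep_sumr (J : finType) v (f : J -> ophil V) :
  oprep v (\sum_i f i) = \sum_i oprep v (f i).
Proof. exact: linear_sumr. Qed.
Lemma oprep_suml (J : finType) (f : J -> V) h :
  oprep (\sum_i f i) h = \sum_i oprep (f i) h.
Proof. exact: linear_sumlz. Qed.

Lemma oprep_inj v w : (forall h, oprep v h = oprep w h) -> v = w.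
Proof.
move=> vw; apply/eqP; rewrite -subr_eq0; apply/eqP/oprep_faithful => h.
by rewrite oprepBl vw subrr.
Qed.

(** Faithfulness of the representation makes adjoints unique. Every later computation of [opstar]
    goes through this criterion. *)
Lemma opstar_uniq v w :
  (forall h k, <<oprep v h, k>> = <<h, oprep w k>> :> R) -> opstar v = w.
Proof.
move=> vw; apply: oprep_inj => k; apply: dot_ext => h.
by rewrite dotC -opstarE vw dotC.
Qed.

Lemma opstarK v : opstar (opstar v) = v.
Proof. by apply: opstar_uniq => h k; rewrite dotC -opstarE dotC. Qed.

Lemma opstarErep v h k : <<h, oprep v k>> = <<oprep (opstar v) h, k>> :> R.
Proof. by rewrite opstarE opstarK. Qed.

Lemma opstar1 : opstar (opone : V) = opone.
Proof. by apply: opstar_uniq => h k; rewrite !oponeE. Qed.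

Lemma opstarP a v w : opstar (a *: v + w) = a *: opstar v + opstar w.
Proof.
apply: opstar_uniq => h k.
by rewrite oprepDl oprepZl dotDl dotZl !opstarE oprepDl oprepZl dotDr dotZr.
Qed.

Lemma opstarZ a v : opstar (a *: v) = a *: opstar v.
Proof.
by apply: opstar_uniq => h k; rewrite !oprepZl dotZl opstarE dotZr.
Qed.

Lemma opstarN v : opstar (- v) = - opstar v.
Proof. by rewrite -scaleN1r opstarZ scaleN1r. Qed.

Lemma opstarD v w : opstar (v + w) = opstar v + opstar w.
Proof. by rewrite -[v in LHS]scale1r opstarP scale1r. Qed.

Lemma opstar0 : opstar (0 : V) = 0.
Proof. by rewrite -(scale0r (0 : V)) opstarZ !scale0r. Qed.

End RealOpsys.

(** * Operator norms of matrices over an operator system *)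

Section MatrixNorm.
Variables (R : realType) (V : ropsys R).

Lemma oprep_bounded (v : V) :
  exists2 M : R, 0 <= M & forall h, `|oprep v h| <= M * `|h|.
Proof.
have /linear_boundedP := @continuous_linear_bounded _ _ _ 0
  (oprep v : {linear ophil V -> ophil V}) (@oprep_continuous _ _ V v 0).
move=> [M [Mr Mf]]; exists (`|M| + 1); first by rewrite addr_ge0.
move=> h; apply: Mf; rewrite (le_lt_trans (ler_norm M))// ltrDl//.
Qed.

Lemma hnorm2_ge0 (H : hilbert (idfun : R -> R)) n (h : 'I_n -> H) :
  0 <= hnorm2 h.
Proof. exact: sqrtr_ge0. Qed.

Lemma hnorm2_sqr (H : hilbert (idfun : R -> R)) n (h : 'I_n -> H) :
  hnorm2 h ^+ 2 = \sum_i <<h i, h i>>.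
Proof.
rewrite sqr_sqrtr; last by apply: sumr_ge0 => i _; rewrite sqr_ge0.
by apply: eq_bigr => i _; rewrite hdotE.
Qed.

Lemma hnorm2Z (H : hilbert (idfun : R -> R)) n a (h : 'I_n -> H) :
  hnorm2 (fun i => a *: h i) = `|a| * hnorm2 h.
Proof.
apply: (pexpIrn (_ : 0 < 2)%N) => //; rewrite ?nnegrE ?mulr_ge0 ?hnorm2_ge0//.
rewrite exprMn !hnorm2_sqr real_normK ?num_real// mulr_sumr.
by apply: eq_bigr => i _; rewrite dotZl dotZr; ring.
Qed.

Lemma hnorm2_eq0 (H : hilbert (idfun : R -> R)) n (h : 'I_n -> H) :
  hnorm2 h = 0 -> h = fun=> 0.
Proof.
move=> h0; have := hnorm2_sqr h; rewrite h0 expr0n/= => /esym/eqP.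
rewrite psumr_eq0 => [|i _]; last exact: dotxx_ge0.
move=> /allP hi; apply/funext => i; apply/dotxx_eq0/eqP.
by have := hi i (mem_index_enum _).
Qed.

Lemma mxrepZ n (x : 'M[V]_n) a h :
  mxrep x (fun i => a *: h i) = fun i => a *: mxrep x h i.
Proof.
apply/funext => i; rewrite /mxrep scaler_sumr.
by apply: eq_bigr => j _; rewrite oprepZr.
Qed.

Definition bounded_by n (x : 'M[V]_n) (c : R) :=
  forall h : 'I_n -> ophil V,
    \sum_i <<mxrep x h i, mxrep x h i>> <= c ^+ 2 * \sum_i <<h i, h i>> :> R.

Lemma bounded_byP n (x : 'M[V]_n) (c : R) : 0 <= c ->
  bounded_by x c <-> forall h, hnorm2 (mxrep x h) <= c * hnorm2 h.
Proof.
move=> c0; split=> xc h; have := xc h; rewrite -!hnorm2_sqr -exprMn;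
  by rewrite ler_pXn2r// ?nnegrE ?mulr_ge0 ?hnorm2_ge0.
Qed.

(** A crude bound suffices: the [i]-th coordinate of the image is at most the row sum [K i] of the
    entry bounds times [hnorm2 h]. *)
Lemma mxrep_bounded n (x : 'M[V]_n) : exists2 c : R, 0 <= c & bounded_by x c.
Proof.
have [M M0 Mx] : exists2 M : 'I_n -> 'I_n -> R, (forall i j, 0 <= M i j) &
    forall i j h, `|oprep (x i j) h| <= M i j * `|h|.
  have /choice[M MP] : forall ij : 'I_n * 'I_n, exists M : R,
      0 <= M /\ forall h, `|oprep (x ij.1 ij.2) h| <= M * `|h|.
    by move=> ij; have [M ? ?] := oprep_bounded (x ij.1 ij.2); exists M.
  by exists (fun i j => M (i, j)) => i j; have [] := MP (i, j).
pose K i : R := \sum_j M i j.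
have K0 i : 0 <= K i by apply: sumr_ge0.
pose N : R := \sum_i K i ^+ 2.
have N0 : 0 <= N by apply: sumr_ge0 => i _; rewrite sqr_ge0.
exists (Num.sqrt N); first exact: sqrtr_ge0.
move=> h; rewrite sqr_sqrtr// -(hnorm2_sqr h) mulr_suml; apply: ler_sum => i _.
rewrite hdotE -exprMn ler_pXn2r// ?nnegrE ?mulr_ge0 ?hnorm2_ge0//.
rewrite (le_trans (ler_norm_sum _ _ _))// mulr_suml ler_sum// => j _.
rewrite (le_trans (Mx i j _))// ler_wpM2l//.
rewrite -(ler_pXn2r (_ : 0 < 2)%N) ?nnegrE ?hnorm2_ge0//.
rewrite hnorm2_sqr (bigD1 j)//= -hdotE lerDl sumr_ge0// => k _.
exact: dotxx_ge0.
Qed.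

Let normset n (x : 'M[V]_n) :=
  [set hnorm2 (mxrep x h) | h in [set h | hnorm2 h <= 1]].

Let has_sup_normset n (x : 'M[V]_n) : has_sup (normset x).
Proof.
split.
  exists (hnorm2 (mxrep x (fun=> 0))), (fun=> 0) => //=.
  rewrite /hnorm2 big1 ?sqrtr0// => i _; by rewrite normr0 expr0n.
have [c c0 /(bounded_byP _ c0) xc] := mxrep_bounded x; exists c => _ [h h1 <-].
by rewrite (le_trans (xc h))// ler_piMr.
Qed.

Lemma mxnorm_ge0 n (x : 'M[V]_n) : 0 <= mxnorm x.
Proof.
have [[y xy] sx] := has_sup_normset x.
apply: le_trans (ub_le_sup sx xy).
by case: xy => h _ <-; rewrite hnorm2_ge0.
Qed.

Lemma mxnorm_leP n (x : 'M[V]_n) (c : R) : 0 <= c ->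
  mxnorm x <= c <-> bounded_by x c.
Proof.
move=> c0; rewrite bounded_byP//; split=> xc.
  move=> h; have [h0|h0] := eqVneq (hnorm2 h) 0.
    rewrite h0 (hnorm2_eq0 h0) /mxrep mulr0.
    rewrite /hnorm2 big1 ?sqrtr0// => i _.
    rewrite big1 ?normr0 ?expr0n// => k _; by rewrite oprep0r.
  have hp : 0 < hnorm2 h by rewrite lt_def h0 hnorm2_ge0.
  (* By homogeneity it is enough to look at [h] scaled to norm one, a member of the set whose
     supremum is taken. *)
  rewrite -ler_pdivrMr// (le_trans _ xc)// -[leLHS]mulrC.
  have -> : (hnorm2 h)^-1 * hnorm2 (mxrep x h) =
      hnorm2 (mxrep x (fun i => (hnorm2 h)^-1 *: h i)).
    by rewrite mxrepZ hnorm2Z ger0_norm// invr_ge0 hnorm2_ge0.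
  apply: ub_le_sup; first by have [] := has_sup_normset x.
  exists (fun i => (hnorm2 h)^-1 *: h i) => //=.
  by rewrite hnorm2Z ger0_norm ?invr_ge0 ?hnorm2_ge0// mulVf.
apply: ge_sup; first by have [] := has_sup_normset x.
by move=> _ [h h1 <-]; rewrite (le_trans (xc h))// ler_piMr.
Qed.

End MatrixNorm.

(** * The Hilbert space sum of [n] copies of [H] *)

Section HilbertSum.
Variables (R : realType) (H : hilbert (idfun : R -> R)) (n : nat).

Definition hsum_sort (H : Type) (n : nat) : Type := 'I_n -> H.
Local Notation hs := (hsum_sort H n).

HB.instance Definition _ := GRing.Lmodule.copy hs ('I_n -> H).

Definition hsum_dot (h k : hs) : R := \sum_i <<h i, k i>>.

Let hsum_dotC h k : hsum_dot h k = hsum_dot k h.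
Proof. by apply: eq_bigr => i _; rewrite dotC. Qed.

Let hsum_dot_linearl k : linear_for *%R (hsum_dot^~ k).
Proof.
move=> a u v; rewrite /hsum_dot mulr_sumr -big_split/=.
by apply: eq_bigr => i _; rewrite dotDl dotZl.
Qed.

Let hsum_dot_bilinear :
  bilinear_for ( *%R : R -> R -> R) (idfun \; *%R) hsum_dot.
Proof.
split=> [k|h]; first exact: hsum_dot_linearl.
move=> a u v /=; rewrite ![hsum_dot h _]hsum_dotC.
exact: hsum_dot_linearl.
Qed.

HB.instance Definition _ :=
  bilinear_isBilinear.Build R hs hs R _ _ hsum_dot hsum_dot_bilinear.

Let hsum_dot_sym h k : hsum_dot h k = (-1) ^+ false * idfun (hsum_dot k h).
Proof. by rewrite expr0 mul1r hsum_dotC. Qed.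

HB.instance Definition _ :=
  isHermitianSesquilinear.Build R hs false idfun hsum_dot hsum_dot_sym.

Let hsum_dot_gt0 (h : hs) : h != 0 -> 0 < hsum_dot h h.
Proof.
move=> h0; rewrite lt_def sumr_ge0 ?andbT => [|i _]; last exact: dotxx_ge0.
apply: contra h0; rewrite psumr_eq0 => [|i _]; last exact: dotxx_ge0.
move=> /allP hi; apply/eqP/funext => i; apply/dotxx_eq0/eqP.
by have := hi i (mem_index_enum _).
Qed.

HB.instance Definition _ :=
  isDotProduct.Build R hs hsum_dot hsum_dot_gt0.

Let CS (h k : hs) : hsum_dot h k <= hnorm2 h * hnorm2 k.
Proof.
have [k0|k0] := eqVneq k 0.
  rewrite k0 /hsum_dot big1 => [|i _]; last exact: dot0r.
  by rewrite mulr_ge0 ?hnorm2_ge0.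
have kp : 0 < hsum_dot k k by exact: hsum_dot_gt0.
apply: le_trans (ler_norm _) _.
rewrite -(ler_pXn2r (_ : 0 < 2)%N) ?nnegrE ?mulr_ge0 ?hnorm2_ge0//.
rewrite exprMn !hnorm2_sqr real_normK ?num_real// -/(hsum_dot h h) -/(hsum_dot k k).
(* [a *: k] is the projection of [h] onto the line of [k]; Cauchy-Schwarz says that the remainder
   has a nonnegative square norm. *)
pose a := hsum_dot h k / hsum_dot k k.
have : 0 <= hsum_dot (h - a *: k) (h - a *: k).
  by apply: sumr_ge0 => i _; apply: dotxx_ge0.
have eqk := hsum_dotC k h.
have -> : hsum_dot (h - a *: k) (h - a *: k) =
    hsum_dot h h - a *+ 2 * hsum_dot h k + a ^+ 2 * hsum_dot k k.
  rewrite /hsum_dot !mulr_sumr -sumrB -big_split/=; apply: eq_bigr => i _.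
  by rewrite dotBl !dotBr !dotZl !dotZr [X in a * X - _](dotC (k i)); ring.
move=> p; rewrite -subr_ge0.
have -> : hsum_dot h h * hsum_dot k k - hsum_dot h k ^+ 2 =
    (hsum_dot h h - a *+ 2 * hsum_dot h k + a ^+ 2 * hsum_dot k k) *
    hsum_dot k k.
  by rewrite /a; field; rewrite gt_eqF.
by rewrite mulr_ge0// ltW.
Qed.

Let hnorm2D (h k : hs) : hnorm2 (h + k) <= hnorm2 h + hnorm2 k.
Proof.
rewrite -(ler_pXn2r (_ : 0 < 2)%N) ?nnegrE ?addr_ge0 ?hnorm2_ge0//.
rewrite sqrrD !hnorm2_sqr.
have -> : \sum_i <<(h + k) i, (h + k) i>> =
    \sum_i <<h i, h i>> + (hsum_dot h k) *+ 2 + \sum_i <<k i, k i>>.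
  rewrite /hsum_dot -sumrMnl -!big_split/=; apply: eq_bigr => i _.
  by rewrite dotDl !dotDr (dotC (k i)); ring.
by rewrite lerD2r lerD2l lerMn2r CS orbT.
Qed.

Let hnorm2_0 (h : hs) : hnorm2 h = 0 -> h = 0.
Proof. exact: hnorm2_eq0. Qed.

HB.instance Definition _ := Lmodule_isNormed.Build R hs
  hnorm2D (fun a h => hnorm2Z a h) hnorm2_0.

Let hnorm2_ub (h : hs) (e : R) : 0 < e -> (forall i, `|h i| < e / n.+1%:R) ->
  `|h| < e.
Proof.
move=> e0 he; rewrite -(ltr_pXn2r (_ : 0 < 2)%N) ?nnegrE ?(ltW e0)//.
rewrite /Num.norm/= hnorm2_sqr.
(* There are [n] terms and [n < n.+1 ^ 2]; the successor also covers [n = 0]. *)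
apply: (@le_lt_trans _ _ (\sum_(i < n) (e / n.+1%:R) ^+ 2)).
  apply: ler_sum => i _; rewrite hdotE ler_pXn2r ?nnegrE ?(ltW (he i))//.
  by rewrite divr_ge0// ltW.
rewrite sumr_const card_ord expr_div_n -mulrnAl.
rewrite ltr_pdivrMr ?exprn_gt0// -mulr_natr ltr_pM2l ?exprn_gt0//.
rewrite -natrX ltr_nat.
by rewrite (leq_trans (ltnSn _))// leq_pmulr.
Qed.

Let coord_le (h : hs) i : `|h i| <= `|h|.
Proof.
rewrite -(ler_pXn2r (_ : 0 < 2)%N) ?nnegrE// -hdotE.
rewrite /Num.norm/= hnorm2_sqr (bigD1 i)//= lerDl sumr_ge0// => k _.
exact: dotxx_ge0.
Qed.

Let hs_complete (F : set_system hs) : ProperFilter F -> cauchy F -> cvg F.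
Proof.
move=> FF /cauchyP Fc.
have Fi i : cvg ((fun h : hs => h i) @ F).
  apply: cauchy_cvg; apply/cauchyP => e e0; have [h hF] := Fc e e0.
  exists (h i); rewrite nbhs_simpl.
  apply: (@filterS _ F _ (ball h e) [set k : hs | ball (h i) e (k i)]) => //.
  move=> k; rewrite -!ball_normE/=; apply: le_lt_trans.
  exact: (coord_le (h - k) i).
pose l : hs := fun i => lim ((fun h : hs => h i) @ F).
apply/cvg_ex; exists l; apply/fcvgrPdist_lt => e e0.
have : \forall h \near F, forall i, `|l i - (h : hs) i| < e / n.+1%:R.
  apply: filter_forall => i.
  by have /cvgrPdist_lt/(_ (e / n.+1%:R)) := Fi i; apply; rewrite divr_gt0.
by apply: filterS => h hi; apply: hnorm2_ub.
Qed.

HB.instance Definition _ := Uniform_isComplete.Build hs hs_complete.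

Let hsum_dotE (h : hs) : hsum_dot h h = `|h| ^+ 2.
Proof. by rewrite /Num.norm/= hnorm2_sqr. Qed.

Definition hsum : hilbert (idfun : R -> R) :=
  @Hilbert R idfun hs hsum_dot hsum_dotE.

Lemma hsum_dot_def (h k : hsum) : <<h, k>> = \sum_i <<h i, k i>> :> R.
Proof. by []. Qed.

End HilbertSum.

(** * Matrices over [V] as an operator system on the Hilbert sum *)

Section MatrixOpsys.
Variables (R : realType) (V : ropsys R) (n : nat).

Definition mx_sort (V : Type) (n : nat) : Type := 'M[V]_n.
Local Notation Mn := (mx_sort V n).

HB.instance Definition _ := GRing.Zmodule.copy Mn 'M[V]_n.

Definition mx_scale (a : R) (x : Mn) : Mn := map_mx ( *:%R a) x.

Let mx_scaleA a b x : mx_scale a (mx_scale b x) = mx_scale (a * b) x.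
Proof. by apply/matrixP => i j; rewrite !mxE scalerA. Qed.

Let mx_scale1 : left_id 1 mx_scale.
Proof. by move=> x; apply/matrixP => i j; rewrite !mxE scale1r. Qed.

Let mx_scaleDr : right_distributive mx_scale +%R.
Proof. by move=> a x y; apply/matrixP => i j; rewrite !mxE scalerDr. Qed.

Let mx_scaleDl x : {morph mx_scale^~ x : a b / a + b}.
Proof. by move=> a b; apply/matrixP => i j; rewrite !mxE scalerDl. Qed.

HB.instance Definition _ := GRing.Zmodule_isLmodule.Build R Mn
  mx_scaleA mx_scale1 mx_scaleDr mx_scaleDl.

Local Notation H := (hsum (ophil V) n).

Definition mx_rep (x : Mn) (h : H) : H := mxrep x h.

Let mx_rep_bilinear : bilinear_for ( *:%R : R -> H -> H) *:%R mx_rep.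
Proof.
split=> [h|x] a u v; apply/funext => i.
  rewrite -[RHS]/(a *: mxrep u h i + mxrep v h i) /mx_rep /mxrep.
  rewrite scaler_sumr -big_split/=; apply: eq_bigr => k _.
  by rewrite !mxE oprepDl oprepZl.
rewrite -[RHS]/(a *: mxrep x u i + mxrep x v i) /= /mx_rep /mxrep.
rewrite scaler_sumr -big_split/=; apply: eq_bigr => k _.
by rewrite oprepDr oprepZr.
Qed.

HB.instance Definition _ :=
  bilinear_isBilinear.Build R Mn H H _ _ mx_rep mx_rep_bilinear.

Let mx_rep_continuous (x : Mn) : continuous (mx_rep x).
Proof.
pose f : {linear H -> H} := (mx_rep : {bilinear Mn -> H -> H}) x.
suff : bounded_near f (nbhs (0 : H)) by move/bounded_linear_continuous.
apply/linear_boundedP.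
have [c c0 /(bounded_byP _ c0) xc] := mxrep_bounded x.
exists c; split; first exact: num_real.
by move=> r cr h; rewrite (le_trans (xc h))// ler_wpM2r ?hnorm2_ge0 ?ltW.
Qed.

Definition single (j : 'I_n) (h : ophil V) : H := fun k => if k == j then h else 0.

Lemma mxrep_single (x : 'M[V]_n) j h i : mxrep x (single j h) i = oprep (x i j) h.
Proof.
rewrite /mxrep (bigD1 j)//= /single eqxx big1 ?addr0// => k /negPf ->.
exact: oprep0r.
Qed.

Let mx_rep_faithful (x : Mn) : (forall h, mx_rep x h = 0) -> x = 0.
Proof.
move=> x0; apply/matrixP => i j; rewrite mxE; apply: oprep_faithful => h.
have /(congr1 (fun f : H => f i)) := x0 (single j h).
by rewrite /mx_rep mxrep_single.
Qed.

Definition mx_opspace : ropspace R :=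
  @OpSpace R idfun Mn H mx_rep mx_rep_continuous mx_rep_faithful.

Definition mx_one : Mn := \matrix_(i, j) (opone *+ (i == j)).
Definition mx_star (x : Mn) : Mn := \matrix_(i, j) opstar (x j i).

Let mx_oneE h : mx_rep mx_one h = h.
Proof.
apply/funext => i; rewrite /mx_rep /mxrep (bigD1 i)//= mxE eqxx oponeE.
rewrite big1 ?addr0// => k ki; rewrite mxE eq_sym (negPf ki).
exact: oprep0l.
Qed.

Let mx_starE (x : Mn) (h k : H) : <<mx_rep x h, k>> = <<h, mx_rep (mx_star x) k>> :> R.
Proof.
rewrite !hsum_dot_def /mx_rep /mxrep.
under eq_bigr do rewrite dot_suml.
under [RHS]eq_bigr do rewrite dot_sumr.
rewrite exchange_big; apply: eq_bigr => i _; apply: eq_bigr => j _.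
by rewrite opstarE mxE.
Qed.

Definition mx_opsys : ropsys R :=
  @OpSys R idfun mx_opspace mx_one mx_star mx_oneE mx_starE.

Lemma mxposE (x : mx_opsys) :
  mxpos (x : 'M[V]_n) <-> opstar x = x /\ forall h, 0 <= <<oprep x h, h>> :> R.
Proof.
split=> -[xs xp]; split=> //.
  by apply/matrixP => i j; rewrite mxE xs.
by move=> i j; move/matrixP: xs => /(_ j i); rewrite mxE.
Qed.

Lemma mxnorm_bound (x : mx_opsys) (c : R) : 0 <= c ->
  mxnorm (x : 'M[V]_n) <= c <->
  forall h, <<oprep x h, oprep x h>> <= c ^+ 2 * <<h, h>> :> R.
Proof. exact: mxnorm_leP. Qed.

End MatrixOpsys.

(** * Two by two block matrices, and norms expressed through positivity *)

Section BlockMatrices.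
Variables (R : realType) (V : ropsys R) (n : nat).
Implicit Types (a b c d x : mx_opsys V n).

Definition hpair (H : hilbert (idfun : R -> R)) (h k : hsum H n) : hsum H (n + n) :=
  fun i => match fintype.split i with inl i => h i | inr i => k i end.

Lemma hpair_lshift (H : hilbert (idfun : R -> R)) (h k : hsum H n) i :
  hpair h k (lshift n i) = h i.
Proof. by rewrite /hpair (unsplitK (inl i)). Qed.

Lemma hpair_rshift (H : hilbert (idfun : R -> R)) (h k : hsum H n) i :
  hpair h k (rshift n i) = k i.
Proof. by rewrite /hpair (unsplitK (inr i)). Qed.

Lemma hpairP (H : hilbert (idfun : R -> R)) (g : hsum H (n + n)) :
  exists h k, g = hpair h k.
Proof.
exists (fun i => g (lshift n i)), (fun i => g (rshift n i)).
apply/funext => i; rewrite /hpair; case: fintype.splitP => k ik; congr g;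
  exact: val_inj.
Qed.

Lemma hpair_dot (H : hilbert (idfun : R -> R)) (h k h' k' : hsum H n) :
  <<hpair h k, hpair h' k'>> = <<h, h'>> + <<k, k'>> :> R.
Proof.
rewrite hsum_dot_def big_split_ord/=; congr (_ + _); apply: eq_bigr => i _.
  by rewrite !hpair_lshift.
by rewrite !hpair_rshift.
Qed.

Definition mxblock2 a b c d : mx_opsys V (n + n) := @block_mx V n n n n a b c d.

Lemma mxblock2_rep a b c d (h k : hsum (ophil V) n) :
  oprep (mxblock2 a b c d) (hpair h k) =
  hpair (oprep a h + oprep b k) (oprep c h + oprep d k).
Proof.
apply/funext => i; rewrite -[LHS]/(mxrep _ _ _) /mxrep big_split_ord/=.
under eq_bigr do rewrite hpair_lshift.
under [X in _ + X]eq_bigr do rewrite hpair_rshift.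
rewrite /mxblock2 -(splitK i); case: (fintype.split i) => /= {}i.
  rewrite hpair_lshift; congr (_ + _); apply: eq_bigr => j _.
    by rewrite block_mxEul.
  by rewrite block_mxEur.
rewrite hpair_rshift; congr (_ + _); apply: eq_bigr => j _.
  by rewrite block_mxEdl.
by rewrite block_mxEdr.
Qed.

Lemma mxblock2_star a b c d :
  opstar (mxblock2 a b c d) = mxblock2 (opstar a) (opstar c) (opstar b) (opstar d).
Proof.
apply: opstar_uniq => h k; have [h1 [h2 ->]] := hpairP h.
have [k1 [k2 ->]] := hpairP k; rewrite !mxblock2_rep !hpair_dot.
by rewrite !dotDl !dotDr !(@opstarErep _ (mx_opsys V n)) !opstarK; ring.
Qed.

Lemma mxpos_contraction (c : R) x : 0 < c ->
  mxpos (mxblock2 (c *: opone) x (opstar x) (c *: opone) : 'M[V]__) <->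
  mxnorm (x : 'M[V]_n) <= c.
Proof.
move=> c0; rewrite (mxposE (_ : mx_opsys V _)).
rewrite mxblock2_star !opstarZ !opstar1 opstarK mxnorm_bound ?ltW//.
split=> [[_ xp] h|xc].
  (* This vector makes the first coordinate of the image vanish; what remains is
     [c |h|^2 - c^-1 |x h|^2 >= 0]. *)
  have := xp (hpair (- c^-1 *: oprep x h) h).
  rewrite mxblock2_rep hpair_dot !oprepZl !oponeE scalerA mulrN divff ?gt_eqF//.
  rewrite scaleN1r addNr dot0l add0r dotDl -(@opstarErep _ (mx_opsys V n)).
  rewrite !dotZl => p.
  have := mulr_ge0 p (ltW c0).
  rewrite mulrDl mulrAC mulNr mulVf ?gt_eqF//.
  by lra.
split=> // h; have [h1 [h2 ->]] := hpairP h.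
rewrite mxblock2_rep hpair_dot !oprepZl !oponeE !dotDl !dotZl.
rewrite -(@opstarErep _ (mx_opsys V n)).
rewrite -(pmulr_rge0 _ c0).
(* Completing the square: [c] times the form is [|c h1 + x h2|^2 + (c^2 |h2|^2 - |x h2|^2)]. *)
have := dotxx_ge0 (c *: h1 + oprep x h2); have := xc h2.
rewrite dotDl !dotDr !dotZl !dotZr (dotC h1 (oprep x h2)).
by lra.
Qed.

End BlockMatrices.

Section CompleteOrder.
Variables (R : realType) (V W : ropsys R) (f : {linear V -> W}).

Definition mxmap n (x : mx_opsys V n) : mx_opsys W n := @map_mx V W f n n x.

Lemma mxmap_block2 n (a b c d : mx_opsys V n) :
  mxmap (mxblock2 a b c d) = mxblock2 (mxmap a) (mxmap b) (mxmap c) (mxmap d).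
Proof. exact: map_block_mx. Qed.

Hypothesis f1 : f opone = opone.

Lemma mxmap_scalar n (c : R) :
  mxmap (c *: (opone : mx_opsys V n)) = c *: (opone : mx_opsys W n).
Proof. by apply/matrixP => i j; rewrite !mxE linearZ raddfMn/= f1. Qed.

(** For [c] large the matrix with diagonal [c] and off-diagonal entries [v] and its adjoint is
    positive. Its image is positive, hence selfadjoint, and the off-diagonal entries of the image
    are compared. *)
Lemma ucp_star : ucp f -> forall v, f (opstar v) = opstar (f v).
Proof.
move=> [_ fp] v; pose x : mx_opsys V 1 := (const_mx v : 'M[V]_1).
have [c c0] := mxrep_bounded x.
move=> /(mxnorm_leP _ c0) xc.
have c1 : 0 < c + 1 by rewrite ltr_wpDl.
have /(mxpos_contraction x c1)/fp : mxnorm (x : 'M[V]_1) <= c + 1.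
  by rewrite (le_trans xc)// lerDl.
rewrite -/(mxmap _) mxmap_block2 => -[/(_ (lshift 1 ord0) (rshift 1 ord0))].
by rewrite /mxblock2 block_mxEur block_mxEdl !mxE.
Qed.

Lemma mxmap_star n (x : mx_opsys V n) : (forall v, f (opstar v) = opstar (f v)) ->
  mxmap (opstar x) = opstar (mxmap x).
Proof. by move=> fs; apply/matrixP => i j; rewrite !mxE fs. Qed.

End CompleteOrder.

Lemma order_embedding_ucp (R : realType) (V W : ropsys R) (f : {linear V -> W}) :
  unital_complete_order_embedding f -> ucp f.
Proof. by move=> [_ f1 fp]; split=> // n x /fp. Qed.

Lemma order_embedding_isometry (R : realType) (V W : ropsys R)
    (f : {linear V -> W}) :
  unital_complete_order_embedding f -> complete_isometry f.
Proof.
move=> fe; have [_ f1 fp] := fe; have fs := ucp_star (order_embedding_ucp fe).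
move=> n x.
have key c : 0 < c -> mxnorm (map_mx f x) <= c <-> mxnorm x <= c.
  move=> c0; pose X : mx_opsys V n := x.
  have E : mxmap f (mxblock2 (c *: opone) X (opstar X) (c *: opone)) =
      mxblock2 (c *: opone) (mxmap f X) (opstar (mxmap f X)) (c *: opone).
    by rewrite mxmap_block2 !mxmap_scalar// mxmap_star.
  rewrite -(mxpos_contraction (mxmap f X) c0) -(mxpos_contraction X c0) -E.
  exact: fp.
(* The slack [e] is there because [key] is only available for strictly positive bounds, while a norm
   may be zero. *)
apply/eqP; rewrite eq_le; apply/andP; split; apply/ler_addgt0Pr => e e0;
  apply/key; rewrite ?lerDl ?ltr_wpDl ?mxnorm_ge0// ltW//.
Qed.

(** Induction on the size through the Schur complement of the top left entry. Later uses need the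
    factor to be invertible, not triangular. *)
Lemma cholesky (R : rcfType) n (M : 'M[R]_n) : M^T = M ->
  (forall v : 'cV_n, v != 0 -> 0 < (v^T *m M *m v) 0 0) ->
  exists2 A, A \in unitmx & M = A *m A^T.
Proof.
elim: n M => [|n IH] M Msym Mpos.
  by exists 1%:M; rewrite ?unitmx1// [M]flatmx0 [RHS]flatmx0.
pose a := M 0 0; pose N : 'M_(1 + n) := M.
pose b : 'cV_n := dlsubmx N; pose D : 'M_n := drsubmx N.
have NE : N = block_mx a%:M b^T b D.
  rewrite -[LHS]submxK; congr block_mx.
    by rewrite [LHS]mx11_scalar !mxE; congr ((M _ _)%:M); exact: val_inj.
  by rewrite /b trmx_dlsub [N^T]Msym.
have form (t : 'cV_1) (v : 'cV_n) : (col_mx t v)^T *m N *m col_mx t v =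
    t^T *m (a *: t) + v^T *m b *m t + t^T *m b^T *m v + v^T *m D *m v.
  rewrite NE tr_col_mx mul_row_block mul_row_col !mulmxDl.
  by rewrite mul_mx_scalar -scalemxAl scalemxAr !addrA.
have nz (t : 'cV_1) (v : 'cV_n) :
    (t != 0) || (v != 0) -> (col_mx t v : 'cV_(1 + n)) != 0.
  by rewrite col_mx_eq0 negb_and.
have a_gt0 : 0 < a.
  have := Mpos (col_mx (1%:M : 'cV_1) (0 : 'cV_n)).
  rewrite form !(trmx0, mul0mx, mulmx0) !addr0 trmx1 mul1mx !mxE mulr1; apply.
  by apply: nz; rewrite oner_eq0.
have [] := IH (D - a^-1 *: (b *m b^T)).
- rewrite linearB linearZ/= trmx_mul trmxK; congr (_ - _).
  by rewrite /D trmx_drsub [N^T]Msym.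
(* For fixed [v] this [t] minimises the form of [M] at [col_mx t v]; the minimum is the form of the
   Schur complement at [v]. *)
- move=> v v0; pose t := - (a^-1 *: (b^T *m v)).
  have := Mpos (col_mx t v); rewrite form nz ?v0 ?orbT// => /(_ isT).
  have -> : a *: t = - (b^T *m v).
    by rewrite scalerN scalerA divff ?gt_eqF// scale1r.
  rewrite mulmxN -(mulmxA t^T) [- _ + _ + _]addrAC addNr add0r.
  rewrite /t mulmxN -scalemxAr mulmxBr mulmxBl -scalemxAr -scalemxAl !mulmxA.
  by rewrite addrC.
move=> A Au DE; pose s := Num.sqrt a.
have s0 : s != 0 by rewrite sqrtr_eq0 -ltNge.
have ss : s * s = a by rewrite -expr2 sqr_sqrtr// ltW.
pose L : 'M_(1 + n) := block_mx s%:M 0 (s^-1 *: b) A.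
have Lu : L \in unitmx.
  by rewrite unitmxE det_lblock det_scalar1 unitrM unitfE s0 -unitmxE.
exists L => //; rewrite -[LHS]/N NE -[RHS]/(L *m L^T) /L.
rewrite tr_block_mx mulmx_block trmx0 !mul0mx !mulmx0 !addr0.
rewrite tr_scalar_mx -scalar_mxM ss linearZ/= mul_scalar_mx scalerA divff//.
rewrite scale1r mul_mx_scalar scalerA divff// scale1r -scalemxAl -scalemxAr.
by rewrite scalerA -invfM ss -DE addrC subrK.
Qed.

(** * The Paulsen system of a column multiplier *)

Section ScalarMatrices.
Variables (R : realType) (H : hilbert (idfun : R -> R)) (n : nat).
Implicit Types (A B : 'M[R]_n) (h k : hsum H n).

(** The scalar matrix [A] tensored with the identity of [H]. *)
Definition mxact A h : hsum H n := fun i => \sum_j A i j *: h j.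

Lemma mxactM A B h : mxact A (mxact B h) = mxact (A *m B) h.
Proof.
apply/funext => i; rewrite /mxact; under eq_bigr do rewrite scaler_sumr.
rewrite exchange_big; apply: eq_bigr => j _; rewrite mxE scaler_suml.
by apply: eq_bigr => l _; rewrite scalerA.
Qed.

Lemma mxact1 h : mxact 1%:M h = h.
Proof.
apply/funext => i; rewrite /mxact (bigD1 i)//= mxE eqxx scale1r big1 ?addr0//.
by move=> j ji; rewrite mxE eq_sym (negPf ji) scale0r.
Qed.

Lemma mxactD A B h : mxact (A + B) h = mxact A h + mxact B h.
Proof.
apply/funext => i; rewrite -[RHS]/(mxact A h i + mxact B h i) -big_split/=.
by apply: eq_bigr => j _; rewrite mxE scalerDl.
Qed.

Lemma mxact_scalar (a : R) h : mxact a%:M h = a *: h.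
Proof.
apply/funext => i; rewrite /mxact (bigD1 i)//= mxE eqxx big1 ?addr0//.
by move=> j ji; rewrite mxE eq_sym (negPf ji) scale0r.
Qed.

Lemma mxactN A h : mxact A (- h) = - mxact A h.
Proof.
apply/funext => i; rewrite -[RHS]/(- mxact A h i) -sumrN.
by apply: eq_bigr => j _; rewrite -scalerN.
Qed.

Lemma mxact_dot A h k : <<mxact A h, k>> = <<h, mxact A^T k>> :> R.
Proof.
rewrite !hsum_dot_def; under eq_bigr do rewrite dot_suml.
under [RHS]eq_bigr do rewrite dot_sumr.
rewrite exchange_big; apply: eq_bigr => i _; apply: eq_bigr => j _.
by rewrite dotZl dotZr mxE.
Qed.

End ScalarMatrices.

Section Bimodule.
Variables (R : realType) (V : ropsys R) (n : nat).

(** The product [A x B], with scalar matrices on both sides of a matrix over [V]. *)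
Definition mxlr (A B : 'M[R]_n) (x : mx_opsys V n) : mx_opsys V n :=
  \matrix_(i, j) \sum_k \sum_l (A i k * B l j) *: (x : 'M_n) k l.

Lemma mxlr_rep A B x h : oprep (mxlr A B x) h = mxact A (oprep x (mxact B h)).
Proof.
apply/funext => i; rewrite -[LHS]/(mxrep _ _ _) /mxrep /mxact.
under eq_bigr do rewrite mxE oprep_suml.
rewrite exchange_big; apply: eq_bigr => k _.
rewrite -[oprep x _ k]/(mxrep _ _ k) /mxrep scaler_sumr.
under eq_bigr do rewrite oprep_suml.
rewrite exchange_big; apply: eq_bigr => l _.
rewrite oprep_sumr scaler_sumr; apply: eq_bigr => j _.
by rewrite oprepZl oprepZr scalerA.
Qed.

End Bimodule.

Lemma mxlr_map (R : realType) (V W : ropsys R) (f : {linear V -> W}) n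
    (A B : 'M[R]_n) (x : mx_opsys V n) :
  mxmap f (mxlr A B x) = mxlr A B (mxmap f x).
Proof.
apply/matrixP => i j; rewrite !mxE linear_sum; apply: eq_bigr => k _.
rewrite linear_sum; apply: eq_bigr => l _; by rewrite linearZ mxE.
Qed.

Section Positivity.
Variables (R : realType) (H : hilbert (idfun : R -> R)) (n : nat).

(** A nonzero [h0] carries positivity from the Hilbert sum down to scalar vectors, by testing on [v]
    tensored with [h0]. Adding [e] makes the scalar form definite. *)
Lemma mxact_cholesky (L : 'M[R]_n) (e : R) (h0 : H) : h0 != 0 -> 0 < e ->
  L^T = L -> (forall h : hsum H n, 0 <= <<mxact L h, h>> :> R) ->
  exists2 A, A \in unitmx & L + e%:M = A *m A^T.
Proof.
move=> h0_neq0 e0 Lsym Lpos; apply: cholesky.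
  by rewrite linearD/= tr_scalar_mx Lsym.
move=> v v0.
have dot_gt0 : 0 < <<h0, h0>> :> R.
  by rewrite hdotE exprn_gt0// normr_gt0.
have vv : 0 < (v^T *m v) 0 0.
  rewrite mxE lt_def sumr_ge0 ?andbT => [|i _]; last by rewrite mxE -expr2 sqr_ge0.
  apply: contra v0; rewrite psumr_eq0 => [/allP vi|i _].
    apply/eqP/matrixP => i j; rewrite ord1 mxE; apply/eqP.
    by have := vi i (mem_index_enum _); rewrite mxE -expr2 sqrf_eq0.
  by rewrite mxE -expr2 sqr_ge0.
have Lvv : 0 <= (v^T *m (L *m v)) 0 0.
  rewrite -(pmulr_lge0 _ dot_gt0).
  have -> : (v^T *m (L *m v)) 0 0 * <<h0, h0>> =
      <<mxact L (fun i => v i 0 *: h0), (fun i => v i 0 *: h0) : hsum H n>>.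
    rewrite hsum_dot_def mxE mulr_suml; apply: eq_bigr => i _.
    rewrite !mxE dotZr dot_suml -mulrA mulr_suml; congr (_ * _).
    by apply: eq_bigr => j _; rewrite scalerA dotZl.
  exact: Lpos.
rewrite mulmxDr mulmxDl mul_mx_scalar -scalemxAl -mulmxA mxE ltr_wpDl//.
by rewrite mxE mulr_gt0.
Qed.

End Positivity.

Section ColumnMultiplier.
Variables (R : realType) (V W : ropsys R) (j : {linear V -> W}).
Hypothesis j_emb : unital_complete_order_embedding j.
Variable u : {linear V -> V}.

(** Norms are defined for square matrices only, so the column [x; y] is completed by a zero block
    column. *)
Definition column_contractive := forall n (x y : mx_opsys V n),
  mxnorm (mxblock2 (mxmap u x) 0 y 0 : 'M[V]_(n + n)) <=
  mxnorm (mxblock2 x 0 y 0 : 'M[V]_(n + n)).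

Hypothesis u_col : column_contractive.

(** Since [j] is a complete isometry, contractivity of columns over [V] can be read on vectors of
    the Hilbert space of [W]. *)
Lemma column_contraction n (x y : mx_opsys V n) :
  (forall g, <<oprep (mxmap j x) g, oprep (mxmap j x) g>> +
     <<oprep (mxmap j y) g, oprep (mxmap j y) g>> <= <<g, g>> :> R) ->
  forall g, <<oprep (mxmap j (mxmap u x)) g, oprep (mxmap j (mxmap u x)) g>> +
     <<oprep (mxmap j y) g, oprep (mxmap j y) g>> <= <<g, g>> :> R.
Proof.
have j_iso := order_embedding_isometry j_emb.
have key (z : mx_opsys V n) : mxnorm (mxblock2 z 0 y 0 : 'M[V]_(n + n)) <= 1 <->
    forall g, <<oprep (mxmap j z) g, oprep (mxmap j z) g>> +
     <<oprep (mxmap j y) g, oprep (mxmap j y) g>> <= <<g, g>> :> R.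
  rewrite -j_iso -/(mxmap j _) mxmap_block2 (mxnorm_bound (_ : mx_opsys _ _))//.
  have -> : mxmap j (0 : mx_opsys V n) = 0.
    by apply/matrixP => k l; rewrite !mxE linear0.
  split=> zy g.
    have := zy (hpair g 0).
    by rewrite mxblock2_rep !oprep0l !addr0 !hpair_dot dot0l addr0 expr1n mul1r.
  have [h [k ->]] := hpairP g; rewrite mxblock2_rep !oprep0l !addr0 !hpair_dot.
  by rewrite expr1n mul1r (le_trans (zy h))// lerDl dotxx_ge0.
by move=> /key xy; apply/key; apply: le_trans (u_col x y) xy.
Qed.

Variables (n : nat) (L M : 'M[R]_n) (x y : mx_opsys V n).
Local Notation Hn := (hsum (ophil W) n).

(** The quadratic form of the selfadjoint block matrix with diagonal [L], [M], [M] and third column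
    [z], [y], [M]; the adjoint entries in the third row account for the factor 2. *)
Let q (z : mx_opsys V n) (h0 h1 h2 : Hn) : R :=
  <<mxact L h0, h0>> + <<mxact M h1, h1>> + <<mxact M h2, h2>> +
  (<<oprep (mxmap j z) h2, h0>> + <<oprep (mxmap j y) h2, h1>>) *+ 2.

(* After adding [d > 0] to [L] and [M], Cholesky factors of these blocks turn
   positivity into contractivity of a column [x1; y1]. *)
Lemma column_positive : L^T = L -> M^T = M ->
  (forall h0 h1 h2, 0 <= q x h0 h1 h2) ->
  forall h0 h1 h2, 0 <= q (mxmap u x) h0 h1 h2.
Proof.
move=> Lsym Msym xpos k0 k1 k2.
have [[h0 h0_neq0]|trivW] := pselect (exists h : ophil W, h != 0); last first.
  have triv (h : Hn) : h = 0.
    by apply/funext => i; apply/eqP/negPn/negP => hi; apply: trivW; exists (h i).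
  by rewrite /q (triv k0) (triv k1) (triv k2) !dot0r !addr0 mul0rn addr0.
apply/ler_addgt0Pr => e e0.
(* With [d = e / N] the perturbation changes the form at [k0], [k1], [k2] by at most [e]; the [+ 1]
   keeps [N] positive. *)
pose N : R := <<k0, k0>> + <<k1, k1>> + <<k2, k2>> + 1.
have N0 : 0 < N by rewrite ltr_wpDl// !addr_ge0// dotxx_ge0.
pose d := e / N; have d0 : 0 < d by rewrite divr_gt0.
have [A Au LE] : exists2 A, A \in unitmx & L + d%:M = A *m A^T.
  apply: (mxact_cholesky h0_neq0 d0 Lsym) => h; have := xpos h 0 0.
  by rewrite /q !(oprep0r, dot0l, dot0r, addr0, add0r, mul0rn).
have [B Bu ME] : exists2 B, B \in unitmx & M + d%:M = B *m B^T.
  apply: (mxact_cholesky h0_neq0 d0 Msym) => h; have := xpos 0 h 0.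
  by rewrite /q !(oprep0r, dot0l, dot0r, addr0, add0r, mul0rn).
pose Ai := invmx A; pose Bi := invmx B.
pose x1 := mxlr Ai Bi^T x; pose y1 := mxlr Bi Bi^T y.
have qE z h0' h1 h2 : q z h0' h1 h2 + d * (<<h0', h0'>> + <<h1, h1>> + <<h2, h2>>) =
    <<mxact (A *m A^T) h0', h0'>> + <<mxact (B *m B^T) h1, h1>> +
    <<mxact (B *m B^T) h2, h2>> +
    (<<oprep (mxmap j z) h2, h0'>> + <<oprep (mxmap j y) h2, h1>>) *+ 2.
  rewrite -LE -ME !mxactD !mxact_scalar !dotDl !dotZl /q; ring.
have xy1 g : <<oprep (mxmap j x1) g, oprep (mxmap j x1) g>> +
    <<oprep (mxmap j y1) g, oprep (mxmap j y1) g>> <= <<g, g>> :> R.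
  set p := oprep _ g; set r := oprep (mxmap j y1) g.
  (* At these vectors the perturbed form equals [|g|^2 - |p|^2 - |r|^2], which is the contractivity
     sought. *)
  have : 0 <= q x (- mxact Ai^T p) (- mxact Bi^T r) (mxact Bi^T g) +
      d * (<<- mxact Ai^T p, - mxact Ai^T p>> +
           <<- mxact Bi^T r, - mxact Bi^T r>> +
           <<mxact Bi^T g, mxact Bi^T g>>).
    by rewrite addr_ge0// mulr_ge0 ?(ltW d0)// !addr_ge0// dotxx_ge0.
  have AAi (C : 'M[R]_n) h : C \in unitmx ->
      <<mxact (C *m C^T) (mxact (invmx C)^T h), mxact (invmx C)^T h>> = <<h, h>> :> R.
    move=> Cu; rewrite mxactM -mulmxA -trmx_mul mulVmx// trmx1 mulmx1.
    by rewrite mxact_dot mxactM -trmx_mul mulVmx// trmx1 mxact1.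
  rewrite qE !mxactN !dotNl !dotNr !opprK !AAi//.
  have -> : <<oprep (mxmap j x) (mxact Bi^T g), mxact Ai^T p>> = <<p, p>> :> R.
    by rewrite -mxact_dot -mxlr_rep -mxlr_map.
  have -> : <<oprep (mxmap j y) (mxact Bi^T g), mxact Bi^T r>> = <<r, r>> :> R.
    by rewrite -mxact_dot -mxlr_rep -mxlr_map.
  by lra.
have uxy1 := column_contraction xy1.
apply: (@le_trans _ _ (q (mxmap u x) k0 k1 k2 +
    d * (<<k0, k0>> + <<k1, k1>> + <<k2, k2>>))); last first.
  rewrite lerD2l /d mulrAC ler_pdivrMr// ler_wpM2l ?(ltW e0)//.
  by rewrite /N lerDl.
rewrite qE -!mxactM !(mxact_dot _ (mxact _ _)).
set a := mxact A^T k0; set b := mxact B^T k1; set g := mxact B^T k2.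
have BBi : (invmx Bi)^T = B^T by rewrite invmxK.
(* Here [x = A x1 B^T], and the entrywise maps [u] and [j] commute with multiplication by scalar
   matrices. *)
have xE : <<oprep (mxmap j (mxmap u x)) k2, k0>> =
    <<oprep (mxmap j (mxmap u x1)) g, a>> :> R.
  rewrite -mxact_dot -mxlr_rep -!mxlr_map; congr <<oprep (mxmap j (mxmap u _)) _, _>>.
  apply: oprep_inj => h; rewrite !mxlr_rep !mxactM mulmxV//.
  by rewrite -trmx_mul mulmxV// trmx1 !mxact1.
have yE : <<oprep (mxmap j y) k2, k1>> = <<oprep (mxmap j y1) g, b>> :> R.
  rewrite -mxact_dot -mxlr_rep -!mxlr_map; congr <<oprep (mxmap j _) _, _>>.
  apply: oprep_inj => h; rewrite !mxlr_rep !mxactM mulmxV//.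
  by rewrite -trmx_mul mulmxV// trmx1 !mxact1.
rewrite xE yE; move: (uxy1 g).
set p := oprep (mxmap j (mxmap u x1)) g; set r := oprep (mxmap j y1) g => pr.
(* The perturbed form is [|a + p|^2 + |b + r|^2 + (|g|^2 - |p|^2 - |r|^2)]. *)
have := dotxx_ge0 (a + p); have := dotxx_ge0 (b + r).
rewrite !dotDl !dotDr (dotC a p) (dotC b r).
by lra.
Qed.

End ColumnMultiplier.

(** * Operator subsystems given by a linear parametrisation *)

Section Subsystem.
Variables (R : realType) (F : ropsys R) (L : lmodType R) (i : {linear L -> F}).
Variables (one : L) (star : L -> L).
Hypothesis i_inj : injective i.
Hypothesis i_one : i one = opone.
Hypothesis i_star : forall x, i (star x) = opstar (i x).

Definition sub_rep (x : L) (h : ophil F) : ophil F := oprep (i x) h.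

Let sub_rep_bilinear : bilinear_for ( *:%R : R -> ophil F -> _) *:%R sub_rep.
Proof.
split=> [h|x] a u v; rewrite /sub_rep /=.
  by rewrite linearP oprepDl oprepZl.
by rewrite oprepDr oprepZr.
Qed.

HB.instance Definition _ := bilinear_isBilinear.Build R L (ophil F) (ophil F)
  _ _ sub_rep sub_rep_bilinear.

Let sub_rep_faithful x : (forall h, sub_rep x h = 0) -> x = 0.
Proof.
by move=> x0; apply: i_inj; rewrite linear0; apply: oprep_faithful.
Qed.

Definition sub_opspace : ropspace R :=
  @OpSpace R idfun L (ophil F) sub_rep (fun x => @oprep_continuous _ _ F (i x))
    sub_rep_faithful.

Let sub_oneE h : sub_rep one h = h.
Proof. by rewrite /sub_rep i_one oponeE. Qed.

Let sub_starE x h k : <<sub_rep x h, k>> = <<h, sub_rep (star x) k>> :> R.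
Proof. by rewrite /sub_rep i_star opstarE. Qed.

Definition sub_opsys : ropsys R :=
  @OpSys R idfun sub_opspace one star sub_oneE sub_starE.

Lemma sub_opsys_emb :
  unital_complete_order_embedding (i : {linear sub_opsys -> F}).
Proof.
split=> // n x.
have E h k : mxrep (map_mx i x) h k = mxrep (x : 'M[sub_opsys]_n) h k.
  by apply: eq_bigr => l _; rewrite mxE.
split=> -[xs xp]; split=> [k l|h].
- by apply: i_inj; have := xs k l; rewrite !mxE -i_star.
- by have := xp h; under eq_bigr do rewrite E.
- by rewrite !mxE -i_star; congr (i _); apply: xs.
- by under eq_bigr do rewrite E; apply: xp.
Qed.

End Subsystem.

(** Indices start at 0: the entry (2, 3) of the overview is [o1], [o2] here. *)
Local Notation o0 := (@Ordinal 3 0 isT).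
Local Notation o1 := (@Ordinal 3 1 isT).
Local Notation o2 := (@Ordinal 3 2 isT).

Lemma sum3 (T : nmodType) (F : 'I_3 -> T) : \sum_i F i = F o0 + F o1 + F o2.
Proof.
rewrite !big_ord_recl big_ord0 addr0 addrA.
by congr (F _ + F _ + F _); exact: val_inj.
Qed.

Lemma ord3P (P : 'I_3 -> Prop) : P o0 -> P o1 -> P o2 -> forall i, P i.
Proof.
move=> P0 P1 P2 [[|[|[|//]]] i3]; [move: P0|move: P1|move: P2];
  congr P; exact: val_inj.
Qed.

Section MatrixUnits.
Variables (R : realType) (W : ropsys R).
Implicit Types a b : W.

Definition mxunit (p q : 'I_3) a : mx_opsys W 3 :=
  \matrix_(i, k) (a *+ ((i == p) && (k == q))).

Lemma mxunit_linear p q : linear (mxunit p q).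
Proof.
move=> t a b; apply/matrixP => i k; rewrite !mxE.
by rewrite mulrnDl -scalerMnr.
Qed.

HB.instance Definition _ p q := GRing.isLinear.Build R W (mx_opsys W 3) _
  (mxunit p q) (mxunit_linear p q).

Lemma mxunit_rep p q a (h : hsum (ophil W) 3) :
  oprep (mxunit p q a) h = single p (oprep a (h q)).
Proof.
apply/funext => i; rewrite -[LHS]/(mxrep _ h i) /mxrep (bigD1 q)//= mxE eqxx andbT.
rewrite big1 ?addr0 => [|k kq]; last by rewrite mxE (negPf kq) andbF oprep0l.
by rewrite /single; case: eqP => _ //; rewrite oprep0l.
Qed.

Lemma single_dot p h (k : hsum (ophil W) 3) : <<single p h, k>> = <<h, k p>> :> R.
Proof.
rewrite hsum_dot_def (bigD1 p)//= big1 ?addr0 /single ?eqxx// => i /negPf ->.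
exact: dot0l.
Qed.

Lemma mxunit_star p q a : opstar (mxunit p q a) = mxunit q p (opstar a).
Proof.
apply/matrixP => i k; rewrite !mxE andbC; case: (_ && _) => //.
exact: opstar0.
Qed.

End MatrixUnits.

Section Algebra.
Variables (R : realType) (I : rcstar R).
Implicit Types a b : I.

Lemma cmul_star a b : opstar (cmul a b) = cmul (opstar b) (opstar a).
Proof. by apply: opstar_uniq => h k; rewrite !cmulE !opstarE. Qed.

Lemma cmul1r a : cmul a opone = a.
Proof. by apply: oprep_inj => h; rewrite cmulE oponeE. Qed.

Lemma cmul1l a : cmul opone a = a.
Proof. by apply: oprep_inj => h; rewrite cmulE oponeE. Qed.

End Algebra.

Lemma mxrep_dot (R : realType) (V : ropsys R) n (x : mx_opsys V n)
    (h k : hsum (ophil V) n) :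
  <<oprep x h, k>> = \sum_i \sum_j <<oprep ((x : 'M[V]_n) i j) (h j), k i>> :> R.
Proof. by rewrite hsum_dot_def; apply: eq_bigr => i _; exact: dot_suml. Qed.

Lemma mxact_dotE (R : realType) (H : hilbert (idfun : R -> R)) n (A : 'M[R]_n)
    (h k : hsum H n) :
  <<mxact A h, k>> = \sum_i \sum_j A i j * <<h j, k i>> :> R.
Proof.
rewrite hsum_dot_def; apply: eq_bigr => i _; rewrite dot_suml.
by apply: eq_bigr => j _; rewrite dotZl.
Qed.

Section PaulsenSystem.
Variables (R : realType) (V W : ropsys R) (j : {linear V -> W}).
Hypothesis j_emb : unital_complete_order_embedding j.

(** The parameters of the system, with [x'] and [y'] independent of [x] and [y]; elements need not
    be selfadjoint. [R^o] is the scalar field as a module over itself. *)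
Definition paulsen_sort : Type := (R^o * R^o * (V * V) * (V * V))%type.
HB.instance Definition _ :=
  GRing.Lmodule.copy paulsen_sort (R^o * R^o * (V * V) * (V * V))%type.
Implicit Types s t : paulsen_sort.

Definition psys (l m : R) (x y x' y' : V) : paulsen_sort :=
  (l, m, (x, y), (x', y')).

Definition pl s : R := s.1.1.1.
Definition pm s : R := s.1.1.2.
Definition px s : V := s.1.2.1.
Definition py s : V := s.1.2.2.
Definition px' s : V := s.2.1.
Definition py' s : V := s.2.2.

Definition paulsen_entry s (p q : nat) : W :=
  match p, q with
  | 0%N, 0%N => pl s *: opone
  | 0%N, 2%N => j (px s)
  | 1%N, 1%N | 2%N, 2%N => pm s *: opone
  | 1%N, 2%N => j (py s)
  | 2%N, 0%N => j (px' s)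
  | 2%N, 1%N => j (py' s)
  | _, _ => 0
  end.

Definition paulsen_emb s : mx_opsys W 3 := \matrix_(p, q) paulsen_entry s p q.

Lemma paulsen_emb_linear : linear paulsen_emb.
Proof.
move=> a s t; apply/matrixP => p q; rewrite !mxE; move: p q.
by do 2![apply: ord3P] => /=; rewrite ?linearP ?scaler0 ?addr0// scalerDl scalerA.
Qed.

HB.instance Definition _ := GRing.isLinear.Build R paulsen_sort (mx_opsys W 3) _
  paulsen_emb paulsen_emb_linear.

Definition paulsen_one : paulsen_sort := psys 1 1 0 0 0 0.
Definition paulsen_star s : paulsen_sort :=
  psys (pl s) (pm s) (opstar (px' s)) (opstar (py' s)) (opstar (px s)) (opstar (py s)).

Let js v : j (opstar v) = opstar (j v).
Proof. exact: (ucp_star (order_embedding_ucp j_emb)). Qed.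

Let j_inj : injective j. Proof. by case: j_emb. Qed.

Lemma paulsen_emb_one : paulsen_emb paulsen_one = opone.
Proof.
apply/matrixP => p q; rewrite !mxE; move: p q.
by do 2![apply: ord3P] => /=; rewrite ?linear0// scale1r.
Qed.

Lemma paulsen_emb_star s : paulsen_emb (paulsen_star s) = opstar (paulsen_emb s).
Proof.
apply/matrixP => p q; rewrite !mxE; move: p q.
by do 2![apply: ord3P] => /=; rewrite ?js ?opstarK// ?opstarZ ?opstar1 ?opstar0.
Qed.

Hypothesis W_neq0 : opone != 0 :> W.

(** A nonzero unit lets the scalars [l] and [m] be recovered from the diagonal; the trivial system
    is treated separately in [column_multiplier]. *)
Lemma paulsen_emb_inj : injective paulsen_emb.
Proof.
move=> s t st; have E (p q : 'I_3) : paulsen_entry s p q = paulsen_entry t p q :> W.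
  by move/matrixP: st => /(_ p q); rewrite !mxE.
have oneI : injective (fun a : R => a *: (opone : W)).
  by move=> a b /eqP; rewrite -subr_eq0 -scalerBl scaler_eq0 (negPf W_neq0) orbF
    subr_eq0 => /eqP.
case: s t {st} E => [[[l m] [x y]] [x' y']] [[[l1 m1] [x1 y1]] [x1' y1']] E.
have -> : l = l1 by exact: oneI (E o0 o0).
have -> : m = m1 by exact: oneI (E o1 o1).
have -> : x = x1 by exact: j_inj (E o0 o2).
have -> : y = y1 by exact: j_inj (E o1 o2).
have -> : x' = x1' by exact: j_inj (E o2 o0).
by have -> : y' = y1' by exact: j_inj (E o2 o1).
Qed.

Definition paulsen : ropsys R :=
  sub_opsys paulsen_emb_inj paulsen_emb_one paulsen_emb_star.

Definition paulsen_form n (L M : 'M[R]_n) (x y : mx_opsys V n)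
    (h0 h1 h2 : hsum (ophil W) n) : R :=
  <<mxact L h0, h0>> + <<mxact M h1, h1>> + <<mxact M h2, h2>> +
  (<<oprep (mxmap j x) h2, h0>> + <<oprep (mxmap j y) h2, h1>>) *+ 2.

Section Positive.
Variables (n : nat) (X : 'M[paulsen]_n).
Let L : 'M[R]_n := map_mx pl X.
Let M : 'M[R]_n := map_mx pm X.
Let x : mx_opsys V n := map_mx px X.
Let y : mx_opsys V n := map_mx py X.
Let x' : mx_opsys V n := map_mx px' X.
Let y' : mx_opsys V n := map_mx py' X.

Lemma paulsen_mxpos_sym : mxpos X ->
  [/\ L^T = L, M^T = M, x' = opstar x & y' = opstar y].
Proof.
move=> [Xs _]; split; apply/matrixP => k l; rewrite !mxE.
- by rewrite -(Xs k l).
- by rewrite -(Xs k l).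
- by rewrite -(Xs l k).
- by rewrite -(Xs l k).
Qed.

Lemma paulsen_mxpos_form : mxpos X ->
  forall h0 h1 h2, 0 <= paulsen_form L M x y h0 h1 h2.
Proof.
move=> Xp h0 h1 h2; have [Ls Ms xs ys] := paulsen_mxpos_sym Xp.
(* The canonical shuffle: [n] by [n] matrices of 3 by 3 matrices are read as 3 by 3 matrices of [n]
   by [n] blocks. *)
have [_ /(_ (fun k (p : 'I_3) => nth 0 [:: h0 k; h1 k; h2 k] p))] := Xp.
set S := \sum_i _; suff -> : S = paulsen_form L M x y h0 h1 h2 by [].
have -> : paulsen_form L M x y h0 h1 h2 =
    <<mxact L h0, h0>> + <<mxact M h1, h1>> + <<mxact M h2, h2>> +
    <<oprep (mxmap j x) h2, h0>> + <<oprep (mxmap j y) h2, h1>> +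
    <<oprep (mxmap j x') h0, h2>> + <<oprep (mxmap j y') h1, h2>>.
  rewrite xs ys !(mxmap_star _ js) -!(@opstarErep _ (mx_opsys W n)).
  rewrite /paulsen_form (dotC h0) (dotC h1).
  by ring.
rewrite !mxact_dotE !mxrep_dot -!big_split/=; apply: eq_bigr => k _.
rewrite -!big_split/= /mxrep (@dot_suml _ (hsum (ophil W) 3)).
apply: eq_bigr => l _; rewrite hsum_dot_def sum3.
have rep p : oprep (X k l) (fun p : 'I_3 => nth 0 [:: h0 l; h1 l; h2 l] p) p =
    \sum_(q < 3) oprep (paulsen_entry (X k l) p q) (nth 0 [:: h0 l; h1 l; h2 l] q).
  by rewrite -[LHS]/(mxrep _ _ p); apply: eq_bigr => q _; rewrite mxE.
rewrite !rep !sum3 /= !mxE !oprepZl !oprep0l !oponeE !dotDl !dot0l.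
by rewrite !dotZl; ring.
Qed.

End Positive.

Variable u : {linear V -> V}.

(** The action on the entry [x'] forced by acting with [u] on [x] and preserving adjoints. It also
    exchanges row and column conditions on [u]. *)
Definition star_conj (v : V) : V := opstar (u (opstar v)).

Lemma star_conj_linear : linear star_conj.
Proof. by move=> a v w; rewrite /star_conj opstarP linearP opstarP. Qed.

HB.instance Definition _ := GRing.isLinear.Build R V V _ star_conj star_conj_linear.

(* Compression of the entrywise map to the vector (1, 1, 1) / sqrt 3, so that
   its values are in [W] and not in 3 x 3 matrices over [W]. *)
Definition paulsen_map (s : paulsen) : W :=
  3%:R^-1 *: ((pl s + pm s + pm s) *: opone + j (u (px s)) + j (py s) +
    j (star_conj (px' s)) + j (py' s)).

Lemma paulsen_map_linear : linear paulsen_map.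
Proof.
move=> a s t; rewrite /paulsen_map scalerA mulrC -scalerA -scalerDr.
congr (_ *: _); rewrite !scalerDr.
have -> : (pl (a *: s + t) + pm (a *: s + t) + pm (a *: s + t)) *: (opone : W) =
   a *: ((pl s + pm s + pm s) *: opone) + (pl t + pm t + pm t) *: opone.
  rewrite scalerA -scalerDl; congr (_ *: _).
  rewrite -[pl (_ + _)]/(a * pl s + pl t) -[pm (_ + _)]/(a * pm s + pm t).
  by ring.
rewrite -[px (_ + _)]/(a *: px s + px t) -[py (_ + _)]/(a *: py s + py t).
rewrite -[px' (_ + _)]/(a *: px' s + px' t) -[py' (_ + _)]/(a *: py' s + py' t).
rewrite !linearP [RHS]addrACA [X in _ = X + _]addrACA.
by rewrite [X in _ = X + _ + _]addrACA [X in _ = X + _ + _ + _]addrACA.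
Qed.

HB.instance Definition _ := GRing.isLinear.Build R paulsen W _
  paulsen_map paulsen_map_linear.

Lemma paulsen_map_star s : paulsen_map (paulsen_star s) = opstar (paulsen_map s).
Proof.
case: s => [[[a b] [x y]] [x' y']].
rewrite -[LHS]/(3%:R^-1 *: ((a + b + b) *: opone + j (u (opstar x')) +
  j (opstar y') + j (star_conj (opstar x)) + j (opstar y))).
rewrite -[paulsen_map _]/(3%:R^-1 *: ((a + b + b) *: opone + j (u x) + j y +
  j (star_conj x') + j y')).
rewrite opstarZ !opstarD -!js opstarZ opstar1 /star_conj !opstarK.
congr (_ *: _); rewrite -!addrA; congr (_ + _).
by rewrite addrA addrC -!addrA.
Qed.

Lemma paulsen_map_ucp : column_contractive u -> ucp paulsen_map.
Proof.
move=> u_col; split.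
  rewrite -[LHS]/(paulsen_map paulsen_one) /paulsen_map.
  rewrite /pl /pm /px /py /px' /py' /= !linear0 !addr0 scalerA.
  by rewrite -[RHS]scale1r; congr (_ *: _); field.
move=> n X Xp; have [Ls Ms xs ys] := paulsen_mxpos_sym Xp.
have [Xs _] := Xp; split=> [k l|].
  by rewrite !mxE -(Xs k l) -paulsen_map_star.
suff pos (h : hsum (ophil W) n) :
  0 <= \sum_i <<mxrep (map_mx paulsen_map X) h i, h i>> :> R by exact: pos.
(* Three equal vectors give the compression to (1, 1, 1); dividing by the square of its length
   produces the factor 1/3. *)
have := column_positive j_emb u_col Ls Ms (paulsen_mxpos_form Xp) h h h.
set Q := (X in 0 <= X -> _).
set S := \sum_i _.
suff -> : S = 3%:R^-1 * Q by move=> Q0; rewrite mulr_ge0// invr_ge0.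
pose x : mx_opsys V n := map_mx px X.
pose y : mx_opsys V n := map_mx py X.
pose x' : mx_opsys V n := map_mx px' X.
pose y' : mx_opsys V n := map_mx py' X.
pose ux' : mx_opsys V n := map_mx star_conj x'.
have ux'E : ux' = opstar (mxmap u x).
  rewrite /ux' /x' xs; apply/matrixP => k l.
  by rewrite !mxE /star_conj opstarK.
have <- : <<mxact (map_mx pl X) h, h>> + <<mxact (map_mx pm X) h, h>> +
    <<mxact (map_mx pm X) h, h>> +
    <<oprep (mxmap j (mxmap u x)) h, h>> + <<oprep (mxmap j y) h, h>> +
    <<oprep (mxmap j ux') h, h>> + <<oprep (mxmap j y') h, h>> = Q.
  rewrite ux'E /y' ys !(mxmap_star _ js) -!(@opstarErep _ (mx_opsys W n)).
  by rewrite /Q /paulsen_form !(dotC h); ring.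
rewrite /S !mxact_dotE !mxrep_dot -!big_split/= mulr_sumr; apply: eq_bigr => k _.
rewrite -!big_split/= mulr_sumr /mxrep dot_suml; apply: eq_bigr => l _.
rewrite !mxE /paulsen_map oprepZl dotZl !oprepDl oprepZl oponeE !dotDl !dotZl.
by ring.
Qed.

End PaulsenSystem.

(** * Multipliers from the injective envelope *)

Lemma quadratic_null (R : realFieldType) (b c : R) :
  (forall t, 0 <= t * b *+ 2 + t ^+ 2 * c) -> b = 0.
Proof.
move=> bc; have d0 : 0 < `|c| + 1 by rewrite ltr_wpDl.
(* At this [t] the polynomial is a square multiple of [b ^+ 2] times a negative number, which forces
   [b = 0]. *)
have := bc (- b / (`|c| + 1)).
have -> : - b / (`|c| + 1) * b *+ 2 + (- b / (`|c| + 1)) ^+ 2 * c =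
    (b ^+ 2 / (`|c| + 1) ^+ 2) * (c - (`|c| + 1) *+ 2).
  by field; rewrite gt_eqF.
have cd : c - (`|c| + 1) *+ 2 < 0.
  by have := ler_norm c; have := normr_ge0 c; lra.
rewrite nmulr_lge0// => b0; apply/eqP; rewrite -sqrf_eq0.
have : b ^+ 2 <= 0.
  by rewrite -(pmulr_lle0 _ (_ : 0 < ((`|c| + 1) ^+ 2)^-1))// invr_gt0 exprn_gt0.
by rewrite le_eqVlt ltNge sqr_ge0 orbF.
Qed.

Section EntrywiseForm.
Variables (R : realType) (I : rcstar R) (g : {linear mx_opsys I 3 -> I}).
Hypothesis g_ucp : ucp g.

(* The entry maps of the Schur-type map [[a_pq] |-> [3 g (a_pq E_pq)]]. *)
Definition entry_map (p q : 'I_3) (a : I) : I := 3%:R *: g (mxunit p q a).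

Lemma entry_map_linear p q : linear (entry_map p q).
Proof.
move=> t a b; rewrite /entry_map linearP linearP scalerDr.
by rewrite !scalerA [3%:R * t]mulrC.
Qed.

HB.instance Definition _ p q := GRing.isLinear.Build R I I _
  (entry_map p q) (entry_map_linear p q).

Local Notation vec := (I * 'I_3 * ophil I)%type.

(* The semi-inner product of the Stinespring construction, evaluated on the
   elementary tensors [a (x) e_p (x) h]. *)
Definition stinespring (v w : vec) : R :=
  <<oprep (entry_map w.1.2 v.1.2 (cmul (opstar w.1.1) v.1.1)) v.2, w.2>>.

Lemma stinespringC v w : stinespring v w = stinespring w v.
Proof.
rewrite /stinespring dotC (@opstarErep _ I) /entry_map opstarZ -(ucp_star g_ucp).
by rewrite mxunit_star cmul_star opstarK.
Qed.

(** For elementary tensors with coefficients [a_k] and indices [p_k], the matrix with entries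
    [a_k^* a_l] at position [p_k], [p_l] is a Gram matrix, hence positive, and [g] is completely
    positive. *)
Lemma stinespring_ge0 m (v : 'I_m -> vec) :
  0 <= \sum_k \sum_l stinespring (v l) (v k).
Proof.
pose x : 'M[mx_opsys I 3]_m := \matrix_(k, l)
  mxunit (v k).1.2 (v l).1.2 (cmul (opstar (v k).1.1) (v l).1.1).
have xp : mxpos x.
  split=> [k l|h]; first by rewrite !mxE mxunit_star cmul_star opstarK.
  pose z := \sum_k oprep (v k).1.1 (h k (v k).1.2).
  rewrite (_ : \sum_i _ = <<z, z>>) ?dotxx_ge0//.
  rewrite dot_sumr; apply: eq_bigr => k _.
  rewrite /mxrep (@dot_suml _ (hsum (ophil I) 3)) (@dot_suml _ (ophil I)).
  apply: eq_bigr => l _.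
  by rewrite mxE mxunit_rep single_dot cmulE -(@opstarErep _ I).
have [_ gp] := g_ucp.
have [_ /(_ (fun k => (v k).2))] := gp _ _ xp.
rewrite -(pmulr_rge0 _ (_ : 0 < 3%:R))// mulr_sumr.
congr (0 <= _); apply: eq_bigr => k _.
rewrite /mxrep dot_suml mulr_sumr; apply: eq_bigr => l _.
by rewrite !mxE /stinespring /entry_map oprepZl dotZl.
Qed.

(** Cauchy-Schwarz for a semi-inner product: if [v1 + v2] has length zero it is orthogonal to [w].
    The sum is kept as two terms because it need not be an elementary tensor. *)
Lemma stinespring_null v1 v2 w :
  stinespring v1 v1 + stinespring v1 v2 *+ 2 + stinespring v2 v2 = 0 ->
  stinespring v1 w + stinespring v2 w = 0.
Proof.
move=> v0; apply: (@quadratic_null _ _ (stinespring w w)) => t.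
have := stinespring_ge0 (fun k : 'I_3 =>
  nth w [:: v1; v2; (w.1, t *: w.2)] k).
rewrite !sum3 /=.
have wl v : stinespring (w.1, t *: w.2) v = t * stinespring w v.
  by rewrite /stinespring /= oprepZr dotZl.
have wr v : stinespring v (w.1, t *: w.2) = t * stinespring v w.
  by rewrite /stinespring /= dotZr.
rewrite !wl !wr (stinespringC w v1) (stinespringC w v2) (stinespringC v2 v1).
by move: v0; lra.
Qed.

End EntrywiseForm.

Lemma hilbert_trivial (R : realType) (W : ropsys R) (h : ophil W) :
  opone = 0 :> W -> h = 0.
Proof. by move=> W0; rewrite -(oponeE h) W0 oprep0l. Qed.

Section Multiplier.
Variables (R : realType) (V : ropsys R) (I : rcstar R) (j : {linear V -> I}).
Hypothesis envI : injective_envelope j.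
Variable u : {linear V -> V}.
Hypothesis u_col : column_contractive u.

(** Injectivity extends [paulsen_map] to all 3 by 3 matrices, and the values are read off on the
    Paulsen system. Only the sum of the two diagonal entries is determined there, since both carry
    the same scalar [m]. *)
Lemma entry_map_exists : opone != 0 :> I ->
  exists2 g : {linear mx_opsys I 3 -> I}, ucp g &
    [/\ entry_map g o1 o1 opone + entry_map g o2 o2 opone = 2%:R *: opone,
        forall x, entry_map g o0 o2 (j x) = j (u x),
        forall x, entry_map g o1 o2 (j x) = j x &
        forall x, entry_map g o2 o1 (j x) = j x].
Proof.
move=> I_neq0; have [inj_I j_emb _] := envI.
have s_ucp := paulsen_map_ucp j_emb I_neq0 u_col.
have i_emb := sub_opsys_emb (paulsen_emb_inj j_emb I_neq0)
  (paulsen_emb_one j) (paulsen_emb_star j_emb).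
have [g g_ucp gs] := inj_I _ _ _ _ i_emb s_ucp.
exists g => //.
have key (s : paulsen_sort V) x : paulsen_emb j s = x ->
    3%:R *: g x = 3%:R *: @paulsen_map _ _ _ _ j_emb I_neq0 u s.
  by move=> <-; rewrite -[X in _ = _ *: X]gs.
have Kx (x : I) : 3%:R *: (3%:R^-1 *: x) = x :> I.
  by rewrite scalerA divff ?scale1r ?pnatr_eq0.
have E p q a s : mxunit p q a = paulsen_emb j s ->
    entry_map g p q a = 3%:R *: @paulsen_map _ _ _ _ j_emb I_neq0 u s.
  by move=> pq; apply: key.
split.
- rewrite /entry_map -scalerDr -linearD.
  rewrite (key (psys 0 1 0 0 0 0)).
    rewrite /paulsen_map Kx /pl /pm /px /py /px' /py' /= !linear0 !addr0.
    by rewrite add0r.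
  apply/matrixP => p q; rewrite !mxE; move: p q.
  by do 2![apply: ord3P] => /=; rewrite ?linear0 ?scale0r ?scale1r ?addr0 ?add0r.
- move=> x; rewrite (E _ _ _ (psys 0 0 x 0 0 0)).
    rewrite /paulsen_map Kx /pl /pm /px /py /px' /py' /= !linear0 !addr0.
    by rewrite scale0r add0r.
  apply/matrixP => p q; rewrite !mxE; move: p q.
  by do 2![apply: ord3P] => /=; rewrite ?linear0 ?scale0r.
- move=> x; rewrite (E _ _ _ (psys 0 0 0 x 0 0)).
    rewrite /paulsen_map Kx /pl /pm /px /py /px' /py' /= !linear0 !addr0.
    by rewrite scale0r add0r.
  apply/matrixP => p q; rewrite !mxE; move: p q.
  by do 2![apply: ord3P] => /=; rewrite ?linear0 ?scale0r.
move=> x; rewrite (E _ _ _ (psys 0 0 0 0 0 x)).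
  rewrite /paulsen_map Kx /pl /pm /px /py /px' /py' /= !linear0 !addr0.
  by rewrite scale0r add0r.
apply/matrixP => p q; rewrite !mxE; move: p q.
by do 2![apply: ord3P] => /=; rewrite ?linear0 ?scale0r.
Qed.

Lemma column_multiplier : exists a : I, forall x, j (u x) = cmul a (j x).
Proof.
have [I0|I_neq0] := eqVneq (opone : I) 0.
  exists 0 => x; apply: oprep_inj => h.
  by rewrite (hilbert_trivial h I0) !oprep0r.
have [_ j_emb rigid] := envI; have [_ j1 _] := j_emb.
have [g g_ucp [E1122 E02 E12 E21]] := entry_map_exists I_neq0.
have sE v p h w q k : stinespring g ((v, p), h) ((w, q), k) =
   <<oprep (entry_map g q p (cmul (opstar w) v)) h, k>> by [].
(* The difference of the unit tensors at [o1] and [o2] has square length [2 |h|^2 - 2 |h|^2 = 0], so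
   the two columns of entry maps agree. *)
have eq12 p a : entry_map g p o1 a = entry_map g p o2 a.
  apply: oprep_inj => h; apply: dot_ext => k.
  have := @stinespring_null _ _ g g_ucp (opone, o1, h) (opone, o2, - h) (opstar a, p, k).
  rewrite !sE opstarK !cmul1r !opstar1 !oprepNr !dotNl !dotNr.
  have -> : entry_map g o2 o1 opone = opone by rewrite -j1 E21.
  rewrite opprK oponeE => s0; apply/eqP; rewrite -subr_eq0; apply/eqP/s0.
  rewrite addrAC -dotDl -oprepDl E1122 oprepZl oponeE dotZl; ring.
have e1 : entry_map g o1 o1 opone = opone by rewrite eq12 -j1 E12.
have e11 a : entry_map g o1 o1 a = a.
  (* Placing a positive matrix in the corner [o1], [o1] keeps it positive, so this entry map is ucp;
     it fixes the range of [j]. *)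
  apply: (rigid (entry_map g o1 o1)) => [|x]; last by rewrite /= eq12 E12.
  split=> // n x [xs xp].
  have [_ gp] := g_ucp.
  have /gp[gxs gxp] : mxpos (\matrix_(k, l) mxunit o1 o1 (x k l)).
    split=> [k l|h]; first by rewrite !mxE mxunit_star xs.
    have := xp (fun k => h k o1).
    congr (0 <= _); apply: eq_bigr => k _.
    rewrite /mxrep (@dot_suml _ (hsum (ophil I) 3)) dot_suml.
    by apply: eq_bigr => l _; rewrite mxE mxunit_rep single_dot.
  split=> [k l|h].
    by have := gxs k l; rewrite !mxE /entry_map opstarZ => ->.
  have := gxp h; rewrite -(pmulr_rge0 _ (_ : 0 < 3%:R))// mulr_sumr.
  congr (0 <= _); apply: eq_bigr => k _.
  rewrite /mxrep !dot_suml mulr_sumr; apply: eq_bigr => l _.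
  by rewrite !mxE /entry_map oprepZl dotZl.
exists (entry_map g o0 o1 opone) => x.
rewrite -E02 -eq12; move: (j x) => a.
apply: oprep_inj => h; apply: dot_ext => k; rewrite cmulE.
(* Since the corner map is the identity, [a] tensored with [h] and [1] tensored with [a h] differ by
   a null vector at [o1]. Pairing with the index [o0] moves [a] out of the entry map. *)
have := @stinespring_null _ _ g g_ucp (a, o1, h) (opone, o1, - oprep a h) (opone, o0, k).
rewrite !sE !opstar1 ?cmul1r !cmul1l !e11 !oponeE !oprepNr !dotNl !dotNr.
rewrite opprK cmulE -(@opstarErep _ I) => s0.
apply/eqP; rewrite -subr_eq0; apply/eqP/s0; ring.
Qed.

End Multiplier.

(** * Centralizers of complex operator spaces *)

Lemma mxnorm_star (R : realType) (V : ropsys R) n (x : mx_opsys V n) :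
  mxnorm (opstar x : 'M[V]_n) = mxnorm (x : 'M[V]_n).
Proof.
suff le (z : mx_opsys V n) : mxnorm (opstar z : 'M[V]_n) <= mxnorm (z : 'M[V]_n).
  by apply/eqP; rewrite eq_le le -{1}[x]opstarK le.
apply/ler_addgt0Pr => e e0; set c := mxnorm _ + e.
have c0 : 0 < c by rewrite ltr_wpDl ?mxnorm_ge0.
have /(mxnorm_bound z (ltW c0)) zc : mxnorm (z : 'M[V]_n) <= c.
  by rewrite lerDl ltW.
apply/(mxnorm_bound _ (ltW c0)) => h.
(* Expanding this square and bounding [z] by [c] gives [c^2 |z^* h|^2 <= c^4 |h|^2]; strict
   positivity of [c] allows the division. *)
have := dotxx_ge0 (c ^+ 2 *: h - oprep z (oprep (opstar z) h)).
have := zc (oprep (opstar z) h).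
rewrite dotBl !dotBr !dotZl !dotZr (dotC _ (oprep z _)).
have -> : <<oprep z (oprep (opstar z) h), h>> =
    <<oprep (opstar z) h, oprep (opstar z) h>> :> R by rewrite opstarE.
set p := <<oprep (opstar z) h, _>>; set r := <<oprep z _, _>> => rp q.
have : c ^+ 2 * p <= c ^+ 2 * (c ^+ 2 * <<h, h>>) by move: rp q; lra.
by rewrite ler_pM2l// exprn_gt0.
Qed.

(** * Square roots of -1 in a real C*-algebra *)

Section Skew.
Variables (R : realType) (I : rcstar R) (w : I).
Hypothesis w2 : cmul w w = - opone.

Lemma square_rep h : oprep w (oprep w h) = - h.
Proof. by rewrite -cmulE w2 oprepNl oponeE. Qed.

(** By polarisation [w] preserves the inner product, so [<w h, k> = <w w h, w k> = - <h, w k>]. *)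
Lemma skew_of_isometry :
  (forall h, <<oprep w h, oprep w h>> = <<h, h>> :> R) -> opstar w = - w.
Proof.
move=> w_iso; have wiso h k : <<oprep w h, oprep w k>> = <<h, k>> :> R.
  have := w_iso (h + k); rewrite oprepDr !dotDl !dotDr !w_iso.
  by rewrite (dotC k h) (dotC (oprep w k)); lra.
apply: opstar_uniq => h k.
by rewrite -wiso square_rep dotNl oprepNl dotNr.
Qed.

(** By normality [P = w^* w] is positive with [P^2 = 1]. The vector [d = P h - h] satisfies
    [P d = - d], so [|w d|^2 = - |d|^2] and [d = 0]. *)
Lemma normal_isometry : cmul (opstar w) w = cmul w (opstar w) ->
  forall h, <<oprep w h, oprep w h>> = <<h, h>> :> R.
Proof.
move=> wN h; pose P k := oprep (opstar w) (oprep w k).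
have ws2 k : oprep (opstar w) (oprep (opstar w) k) = - k.
  by rewrite -cmulE -cmul_star w2 opstarN opstar1 oprepNl oponeE.
have PP k : P (P k) = k.
  by rewrite /P -(cmulE w (opstar w)) -wN cmulE square_rep !oprepNr ws2 opprK.
have Pdot k l : <<P k, l>> = <<oprep w k, oprep w l>> :> R.
  by rewrite /P opstarE opstarK.
have PB k l : P (k - l) = P k - P l by rewrite /P !oprepBr.
have Ph : P h - h = 0.
  apply: dotxx_eq0; apply/eqP; rewrite eq_le dotxx_ge0 andbT.
  have := dotxx_ge0 (oprep w (P h - h)).
  by rewrite -Pdot PB PP -(opprB _ h) dotNl oppr_ge0.
by rewrite -Pdot (subr0_eq Ph).
Qed.

End Skew.

(** A norm-preserving surjection [phi] of the unit ball leaves the supremum unchanged. It covers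
    multiplication by diagonal unitaries on either side. *)
Lemma mxnorm_reparam (R : realType) (X : ropspace R) n (x y : 'M[X]_n)
    (phi psi : ('I_n -> ophil X) -> 'I_n -> ophil X) :
  (forall h, hnorm2 (phi h) = hnorm2 h) -> cancel psi phi ->
  (forall h, hnorm2 (mxrep x h) = hnorm2 (mxrep y (phi h))) ->
  mxnorm x = mxnorm y.
Proof.
move=> phi_iso psiK xy; congr sup; apply/seteqP; split=> _ [h /= h1 <-].
  by exists (phi h); rewrite ?xy //= phi_iso.
by exists (psi h); rewrite ?xy ?psiK //= -phi_iso psiK.
Qed.

Section ComplexOpspace.
Variables (R : realType) (X : copspace R).
Local Notation XR := (realify_opspace X).

Lemma realify_normZ (c : R[i]) (h : ophil XR) : `|c| = 1 ->
  `|(c *: (h : ophil X) : ophil XR)| = `|h|.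
Proof. by move=> c1; rewrite !realify_normE normrZ c1 mul1r. Qed.

Lemma hnorm2_unimodular n (c : 'I_n -> R[i]) (h : 'I_n -> ophil XR) :
  (forall i, `|c i| = 1) ->
  hnorm2 (fun i => c i *: (h i : ophil X) : ophil XR) = hnorm2 h.
Proof.
move=> c1; congr Num.sqrt; apply: eq_bigr => i _.
by rewrite realify_normZ.
Qed.

Lemma mxnorm_rowscale n (x : 'M[XR]_n) (c : 'I_n -> R[i]) :
  (forall i, `|c i| = 1) ->
  mxnorm (\matrix_(i, k) (c i *: (x i k : X) : XR)) = mxnorm x.
Proof.
move=> c1; apply: (@mxnorm_reparam _ _ _ _ _ id id) => // h.
rewrite -(hnorm2_unimodular (mxrep x h) c1); congr hnorm2.
apply/funext => i; rewrite /mxrep; under eq_bigr do rewrite mxE.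
rewrite -[RHS]/(c i *: (\sum_k oprep (x i k : X) (h k) : ophil X)).
rewrite scaler_sumr; apply: eq_bigr => k _.
by rewrite -[LHS]/(oprep (c i *: (x i k : X)) (h k)) linearZl_LR.
Qed.

Lemma mxnorm_colscale n (x : 'M[XR]_n) (c : 'I_n -> R[i]) :
  (forall i, `|c i| = 1) ->
  mxnorm (\matrix_(i, k) (c k *: (x i k : X) : XR)) = mxnorm x.
Proof.
move=> c1; pose phi (h : 'I_n -> ophil XR) k : ophil XR := c k *: (h k : ophil X).
pose psi (h : 'I_n -> ophil XR) k : ophil XR := (c k)^-1 *: (h k : ophil X).
apply: (@mxnorm_reparam R XR n _ x phi psi).
- by move=> h; apply: hnorm2_unimodular.
- move=> h; apply/funext => k; rewrite /phi /psi scalerA divff ?scale1r//.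
  by rewrite -normr_eq0 c1 oner_eq0.
- move=> h; congr hnorm2; apply/funext => i; apply: eq_bigr => k _.
  rewrite mxE -[LHS]/(oprep (c k *: (x i k : X)) (h k)).
  by rewrite -[RHS]/(oprep (x i k : X) (c k *: (h k : ophil X))) linearZl_LR linearZr_LR.
Qed.

End ComplexOpspace.

Section ImaginaryUnit.
Variables (R : realType) (V : ropsys R) (X : copspace R).
Variables (f : {linear V -> realify_opspace X}) (g : realify_opspace X -> V).
Hypotheses (f_iso : complete_isometry f) (fK : cancel f g) (gK : cancel g f).

Local Notation "'I" := ('i : R[i]).

Definition imag_mul (v : V) : V := g ('I *: (f v : X)).

Lemma imag_mulE v : f (imag_mul v) = 'I *: (f v : X).
Proof. exact: gK. Qed.

Lemma imag_mul_linear : linear imag_mul.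
Proof.
move=> a v w; apply: (can_inj fK); rewrite linearP !imag_mulE linearP.
rewrite -[RHS]/(a%:C *: ('I *: (f v : X)) + 'I *: (f w : X)).
rewrite -[X in _ *: X]/(a%:C *: (f v : X) + (f w : X)).
by rewrite scalerDr !scalerA mulrC.
Qed.

HB.instance Definition _ := GRing.isLinear.Build R V V _ imag_mul imag_mul_linear.

Lemma imag_mulK v : imag_mul (imag_mul v) = - v.
Proof.
apply: (can_inj fK); rewrite !imag_mulE scalerA -expr2 sqrCi scaleN1r.
by rewrite linearN.
Qed.

(** The phases of the diagonal unitary that multiplies the first block by [i] and fixes the
    second. *)
Let c n (k : 'I_(n + n)) : R[i] := if fintype.split k is inl _ then 'I else 1.

Let c1 n (k : 'I_(n + n)) : `|c k| = 1.
Proof. by rewrite /c; case: fintype.split => _; rewrite ?normCi ?normr1. Qed.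

Lemma imag_mul_column : column_contractive imag_mul.
Proof.
move=> n x y; rewrite -!f_iso -(mxnorm_rowscale (map_mx f (mxblock2 x 0 y 0)) (@c1 n)).
rewrite le_eqVlt; apply/orP; left; apply/eqP; congr mxnorm.
apply/matrixP => i k; rewrite !mxE /c.
case: (fintype.split i) => i'; rewrite !mxE; case: (fintype.split k) => k';
  rewrite ?mxE ?linear0 ?scaler0 ?scale1r//.
by rewrite imag_mulE.
Qed.

(** Adjoints preserve norms and turn the column into the row [x y]; [imag_mul] on its first block is
    then right multiplication by the diagonal unitary. *)
Lemma imag_mul_row : column_contractive (star_conj imag_mul).
Proof.
move=> n x y; rewrite -mxnorm_star -[leRHS]mxnorm_star !mxblock2_star !opstar0.
have -> : opstar (mxmap (star_conj imag_mul) x) = mxmap imag_mul (opstar x).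
  by apply/matrixP => i k; rewrite !mxE /star_conj opstarK.
move: (opstar x) (opstar y) => {}x {}y.
rewrite -!f_iso -(mxnorm_colscale (map_mx f (mxblock2 x y 0 0)) (@c1 n)).
rewrite le_eqVlt; apply/orP; left; apply/eqP; congr mxnorm.
apply/matrixP => i k; rewrite !mxE /c.
case: (fintype.split i) => i'; rewrite !mxE; case: (fintype.split k) => k';
  rewrite ?mxE ?linear0 ?scaler0 ?scale1r//.
by rewrite imag_mulE.
Qed.

Lemma imag_mul_exists : exists u : {linear V -> V},
  [/\ forall v, u (u v) = - v, column_contractive u &
      column_contractive (star_conj u)].
Proof.
exists imag_mul; split; [exact: imag_mulK | exact: imag_mul_column |].
exact: imag_mul_row.
Qed.

End ImaginaryUnit.

Lemma centralizer_of_complex_opspace (R : realType) (V : ropsys R) (I : rcstar R)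
    (j : {linear V -> I}) : injective_envelope j ->
  cisometric_to_complex_opspace V ->
  exists2 z : {linear V -> V}, centralizer j z & forall x, z (z x) = - x.
Proof.
move=> envI [X [f [[g fK gK] f_iso]]].
have [_ j_emb _] := envI; have [_ j1 _] := j_emb.
have js := ucp_star (order_embedding_ucp j_emb).
have [u [uu u_col u_row]] := imag_mul_exists f_iso fK gK.
have [a ua] := column_multiplier envI u_col.
have [b ub] := column_multiplier envI u_row.
pose w := j (u opone).
(* Evaluation at the unit identifies the left multiplier [a] with [w], and below the right
   multiplier with the same [w]. *)
have uw x : j (u x) = cmul w (j x).
  by rewrite (_ : w = a)// /w ua j1 cmul1r.
have uwr x : j (u x) = cmul (j x) w.
  (* Taking adjoints turns left multiplication for [star_conj u] into right multiplication for
     [u]. *)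
  have E y : j (u y) = cmul (j y) (opstar b).
    have := ub (opstar y); rewrite /= /star_conj opstarK js js => /(congr1 opstar).
    by rewrite !opstarK cmul_star opstarK.
  by rewrite (_ : w = opstar b)// /w E j1 cmul1l.
have w2 : cmul w w = - opone by rewrite -uw uu linearN j1.
have w_contr h : <<oprep w h, oprep w h>> <= <<h, h>> :> R.
  pose one : mx_opsys V 1 := opone.
  have j_one : mxmap j one = opone by rewrite -[one]scale1r mxmap_scalar// scale1r.
  have j_zero : mxmap j (0 : mx_opsys V 1) = 0.
    by apply/matrixP => k l; rewrite !mxE linear0.
  (* The column [1; 0] is contractive, hence so is its image [w; 0]. *)
  have := @column_contraction _ _ _ _ j_emb _ u_col 1 one 0.
  rewrite j_one j_zero => contr.
  have /contr/(_ (fun=> h)) : forall g : hsum (ophil I) 1,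
      <<oprep (opone : mx_opsys I 1) g, oprep (opone : mx_opsys I 1) g>> +
      <<oprep (0 : mx_opsys I 1) g, oprep (0 : mx_opsys I 1) g>> <= <<g, g>> :> R.
    by move=> g'; rewrite oponeE oprep0l dot0l addr0.
  rewrite oprep0l dot0l addr0 !hsum_dot_def !big_ord1.
  by have -> : oprep (mxmap j (mxmap u one)) (fun=> h) ord0 = oprep w h
    by rewrite -[LHS]/(mxrep _ (fun=> h) ord0) /mxrep big_ord1 !mxE eqxx.
(* The reverse inequality is contractivity at [w h], because [w w h = - h]. *)
have w_iso h : <<oprep w h, oprep w h>> = <<h, h>> :> R.
  apply/eqP; rewrite eq_le w_contr/=.
  by have := w_contr (oprep w h); rewrite (square_rep w2) dotNl dotNr opprK.
have wN := skew_of_isometry w2 w_iso.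
exists u => //; exists w => //; split=> x.
- by exists (u x) => //; rewrite uw.
- exists (- u x) => //; rewrite linearN uw wN; apply: oprep_inj => h.
  by rewrite oprepNl !cmulE oprepNl.
- by rewrite -uw uwr.
Qed.

(** * Complex structure from a centralizer *)

Section ComplexLmodule.
Variable R : realType.

(** Bundled so that the type [complexify] can depend on the map and carry the complex scaling it
    induces. *)
Record imag_unit (L : lmodType R) := ImagUnit {
  imag :> {linear L -> L};
  imagK : forall x, imag (imag x) = - x }.

Definition complexify (L : lmodType R) (S : imag_unit L) : Type := L.

Variables (L : lmodType R) (S : imag_unit L).
Local Notation C := (complexify S).

HB.instance Definition _ := GRing.Zmodule.copy C L.

Definition complexify_scale (c : R[i]) (x : C) : C :=
  complex.Re c *: (x : L) + complex.Im c *: S x.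

Let complexify_scaleA a b x :
  complexify_scale a (complexify_scale b x) = complexify_scale (a * b) x.
Proof.
case: a b => [a a'] [b b']; rewrite /complexify_scale /=.
have -> : S (b *: (x : L) + b' *: S x) = b *: S x - b' *: (x : L).
  by rewrite linearD !linearZ/= imagK scalerN.
rewrite scalerDr scalerBr !scalerA scalerBl scalerDl.
by rewrite [X in _ + X = _]addrC addrACA.
Qed.

Let complexify_scale1 : left_id 1 complexify_scale.
Proof. by move=> x; rewrite /complexify_scale /= scale1r scale0r addr0. Qed.

Let complexify_scaleDr : right_distributive complexify_scale +%R.
Proof.
by move=> c x y; rewrite /complexify_scale (raddfD S) !scalerDr addrACA.
Qed.

Let complexify_scaleDl x : {morph complexify_scale^~ x : a b / a + b}.
Proof.
move=> [a a'] [b b']; rewrite /complexify_scale /=.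
by rewrite !scalerDl addrACA.
Qed.

HB.instance Definition _ := GRing.Zmodule_isLmodule.Build R[i] C
  complexify_scaleA complexify_scale1 complexify_scaleDr complexify_scaleDl.

End ComplexLmodule.

(** * The complex Hilbert space of an isometric imaginary unit *)

Section ComplexHilbert.
Variable R : realType.

Record isometric_imag_unit (H : hilbert (idfun : R -> R)) := IsometricImagUnit {
  isom_imag :> imag_unit H;
  isom_imag_dot : forall h k : H, <<isom_imag h, isom_imag k>> = <<h, k>> :> R }.

Definition chilb_sort (H : hilbert (idfun : R -> R)) (J : isometric_imag_unit H) :
  Type := complexify J.

Variables (H : hilbert (idfun : R -> R)) (J : isometric_imag_unit H).
Local Notation HC := (chilb_sort J).

HB.instance Definition _ := GRing.Lmodule.copy HC (complexify J).

Let dotJ (h k : H) : <<J h, k>> = - <<h, J k>> :> R.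
Proof. by rewrite -(isom_imag_dot J) imagK dotNl. Qed.

Let dotxJ (h : H) : <<h, J h>> = 0 :> R.
Proof. by have := dotJ h h; rewrite dotC; lra. Qed.

Definition chilb_norm (h : HC) : R[i] := (`|h : H|)%:C.

Let chilb_normD (h k : HC) : chilb_norm (h + k) <= chilb_norm h + chilb_norm k.
Proof. by rewrite /chilb_norm -rmorphD lecR ler_normD. Qed.

(** Pythagoras: [h] and [J h] are orthogonal and of equal length. *)
Let chilb_normZ (c : R[i]) (h : HC) : chilb_norm (c *: h) = `|c| * chilb_norm h.
Proof.
rewrite /chilb_norm normc_def -rmorphM; congr (_)%:C.
apply: (pexpIrn (_ : 0 < 2)%N) => //; rewrite ?nnegrE ?mulr_ge0 ?sqrtr_ge0//.
rewrite -hdotE exprMn sqr_sqrtr ?addr_ge0 ?sqr_ge0// -hdotE.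
rewrite -[c *: h]/(complex.Re c *: (h : H) + complex.Im c *: J h).
rewrite dotDl !dotDr !dotZl !dotZr isom_imag_dot (dotC (J h)) dotxJ.
by ring.
Qed.

Let chilb_norm0 (h : HC) : chilb_norm h = 0 -> h = 0.
Proof. by move=> /(congr1 (@complex.Re R)) /= /eqP; rewrite normr_eq0 => /eqP. Qed.

HB.instance Definition _ := Lmodule_isNormed.Build R[i] HC
  chilb_normD chilb_normZ chilb_norm0.

(** Positive elements of [R[i]] are real, so both norms have the same balls and completeness is
    inherited from [H]. *)
Let chilb_complete (F : set_system HC) : ProperFilter F -> cauchy F -> cvg F.
Proof.
move=> FF /cauchyP Fc.
have Fcvg : cvg (F : set_system H).
  apply: cauchy_cvg; apply/(cauchyP (T := H)) => e e0.
  have [|h hF] := Fc e%:C; first by rewrite ltcR.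
  exists h; apply: filterS hF => k; rewrite -!ball_normE /=.
  by rewrite -ltcR.
apply/cvg_ex; exists (lim (F : set_system H)).
apply/(fcvgrPdist_lt (V := HC)) => e e0.
have eE : e = (complex.Re e)%:C by rewrite RRe_real// gtr0_real.
move/(fcvgrPdist_lt (V := H)): Fcvg => /(_ (complex.Re e)).
rewrite -ltcR -eE => /(_ e0); apply: filterS => h.
by rewrite -ltcR -eE.
Qed.

HB.instance Definition _ := Uniform_isComplete.Build HC chilb_complete.

(** The form with the given real part that is complex linear in its first argument; the sign of the
    imaginary part comes from [<J h, k> = - <h, J k>]. *)
Definition chilb_dot (h k : HC) : R[i] := <<h : H, k : H>> +i* <<h : H, J k>>.

Let dotxJy (h k : H) : <<h, J k>> = - <<k, J h>> :> R.
Proof. by rewrite (dotC k) dotJ opprK. Qed.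

Let chilb_dot_linearl k : linear_for *%R (chilb_dot^~ k).
Proof.
move=> [a b] u v; rewrite /chilb_dot.
rewrite -[X in <<X, _>>]/(a *: (u : H) + b *: J u + (v : H)).
apply/eqP; rewrite eq_complex /=; apply/andP; split; apply/eqP.
  by rewrite !dotDl !dotZl dotJ /=; ring.
by rewrite !dotDl !dotZl isom_imag_dot /=; ring.
Qed.

Let chilb_dotC h k : chilb_dot h k = (chilb_dot k h)^*.
Proof. by rewrite /chilb_dot /= dotC dotxJy. Qed.

Let chilb_dot_bilinear :
  bilinear_for ( *%R : R[i] -> R[i] -> R[i]) (@conjc R \; *%R) chilb_dot.
Proof.
split=> [k|h]; first exact: chilb_dot_linearl.
move=> c u v /=; rewrite ![chilb_dot h _]chilb_dotC chilb_dot_linearl.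
by rewrite rmorphD rmorphM.
Qed.

HB.instance Definition _ :=
  bilinear_isBilinear.Build R[i] HC HC R[i] _ _ chilb_dot chilb_dot_bilinear.

Let chilb_dot_sym h k : chilb_dot h k = (-1) ^+ false * (chilb_dot k h)^*.
Proof. by rewrite expr0 mul1r chilb_dotC. Qed.

HB.instance Definition _ :=
  isHermitianSesquilinear.Build R[i] HC false (@conjc R) chilb_dot chilb_dot_sym.

Let chilb_dotE (h : HC) : chilb_dot h h = `|h| ^+ 2.
Proof. by rewrite /chilb_dot dotxJ hdotE -rmorphXn. Qed.

Let chilb_dot_gt0 (h : HC) : h != 0 -> 0 < chilb_dot h h.
Proof. by move=> h0; rewrite chilb_dotE exprn_gt0// normr_gt0. Qed.

HB.instance Definition _ :=
  isDotProduct.Build R[i] HC chilb_dot chilb_dot_gt0.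

Definition chilb : hilbert (@conjc R) :=
  @Hilbert R[i] (@conjc R) HC chilb_dot chilb_dotE.

End ComplexHilbert.

(** * The complex operator system acting on this Hilbert space *)

Section ComplexOpsys.
Variables (R : realType) (V I : ropsys R) (j : {linear V -> I}).
Variables (z : imag_unit V) (J : isometric_imag_unit (ophil I)).
Hypothesis j_emb : unital_complete_order_embedding j.
Hypothesis jz : forall v h, oprep (j (z v)) h = J (oprep (j v) h).
Hypothesis jJ : forall v h, oprep (j v) (J h) = J (oprep (j v) h).

Let js v : j (opstar v) = opstar (j v).
Proof. exact: (ucp_star (order_embedding_ucp j_emb)). Qed.

Definition crep (v : complexify z) (h : chilb J) : chilb J := oprep (j v) h.

Let crep_bilinear : bilinear_for ( *:%R : R[i] -> chilb J -> chilb J) *:%R crep.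
Proof.
split=> [h|v] [a b] u u'.
  rewrite -[LHS]/(oprep (j (a *: (u : V) + b *: z u + (u' : V))) h).
  rewrite !linearD !linearZ/= !oprepDl !oprepZl jz.
  by [].
rewrite -[LHS]/(oprep (j v) (a *: (u : ophil I) + b *: J u + (u' : ophil I))).
by rewrite !oprepDr !oprepZr jJ.
Qed.

HB.instance Definition _ := bilinear_isBilinear.Build R[i] (complexify z)
  (chilb J) (chilb J) _ _ crep crep_bilinear.

Let crep_continuous v : continuous (crep v).
Proof.
pose f : {linear chilb J -> chilb J} :=
  (crep : {bilinear complexify z -> chilb J -> chilb J}) v.
suff : bounded_near f (nbhs (0 : chilb J)) by move/bounded_linear_continuous.
apply/linear_boundedP; have [M M0 vM] := oprep_bounded (j v).
exists M%:C; split; first by rewrite ger0_real// lecR.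
move=> r Mr h; apply: (@le_trans _ _ (M%:C * `|h|)).
  by rewrite -rmorphM lecR vM.
by rewrite ler_wpM2r// ltW.
Qed.

Let crep_faithful v : (forall h, crep v h = 0) -> v = 0.
Proof.
have [j_inj _ _] := j_emb => v0; apply: j_inj; rewrite linear0.
exact: oprep_faithful.
Qed.

Definition complex_opspace : copspace R :=
  @OpSpace R[i] (@conjc R) (complexify z) (chilb J) crep crep_continuous crep_faithful.

Let crep_one h : crep (opone : V) h = h.
Proof. by have [_ j1 _] := j_emb; rewrite /crep j1 oponeE. Qed.

(** The real part is the real adjoint relation; the imaginary part also needs the adjoint, again in
    the range of [j], to commute with [J]. *)
Let crep_star v (h k : chilb J) :
  chilb_dot (crep v h) k = chilb_dot h (crep (opstar (v : V)) k).
Proof. by rewrite /chilb_dot /crep !opstarE -js jJ. Qed.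

Definition complex_opsys : copsys R :=
  @OpSys R[i] (@conjc R) complex_opspace (opone : V) (opstar : V -> V)
    crep_one crep_star.

Let emb (v : V) : realify_opsys complex_opsys := v.

Let emb_linear : linear emb.
Proof.
move=> a u v; rewrite -[RHS]/(a *: (u : V) + 0 *: z u + (v : V)).
by rewrite scale0r addr0.
Qed.

HB.instance Definition _ :=
  GRing.isLinear.Build R V (realify_opsys complex_opsys) _ emb emb_linear.

Let emb_mxrep n (x : 'M[V]_n) (h : 'I_n -> ophil I) k :
  mxrep (map_mx emb x) h k = mxrep (map_mx j x) h k :> ophil I.
Proof.
rewrite -[LHS]/(\sum_l oprep (map_mx emb x k l) (h l) : ophil I) /mxrep.
by apply: eq_bigr => l _; rewrite !mxE.
Qed.

(** [emb] is the identity of [V], and its target acts through [j] with the original real inner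
    product, so both cones are those of [j]. *)
Let emb_order : unital_complete_order_embedding emb.
Proof.
have [j_inj _ jp] := j_emb.
split=> // n x; rewrite -jp; split=> -[xs xp]; split.
- move=> k l; have := xs k l; rewrite !mxE -js => xkl.
  by congr (j _); exact: xkl.
- move=> h; rewrite (_ : \sum_i _ = \sum_i
    hdot (ophil (realify_opsys complex_opsys)) (mxrep (map_mx emb x) h i)
      (h i))//.
  by apply: eq_bigr => k _; rewrite -emb_mxrep.
- move=> k l; have := xs k l; rewrite !mxE -js => /j_inj; exact.
move=> h; rewrite (_ : \sum_i _ = \sum_i <<mxrep (map_mx j x) h i, h i : ophil I>>)//.
by apply: eq_bigr => k _; rewrite -emb_mxrep.
Qed.

Lemma complex_opsysP : is_complex_opsys V.
Proof.
exists (@complexify_scale R V z).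
  split; first exact: (@scalerA _ (complexify z)).
  - exact: (@scalerDr _ (complexify z)).
  - by move=> a b v; exact: (@scalerDl _ (complexify z)).
  - by move=> r v; rewrite /complexify_scale /= scale0r addr0.
by exists complex_opsys, emb; split=> //; exists id.
Qed.

End ComplexOpsys.

Lemma complex_opsys_of_centralizer (R : realType) (V : ropsys R) (I : rcstar R)
    (j : {linear V -> I}) (z : {linear V -> V}) : injective_envelope j ->
  centralizer j z -> (forall x, z (z x) = - x) -> is_complex_opsys V.
Proof.
move=> [_ j_emb _] [w [wj wsj wC] zw] zz; have [j_inj j1 _] := j_emb.
have js := ucp_star (order_embedding_ucp j_emb).
have jz1 : j (z opone) = w by rewrite zw j1 cmul1r.
have w2 : cmul w w = - opone by rewrite -{2}jz1 -zw zz linearN j1.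
(* Normality, left open here, holds because [opstar w] lies in the range of [j], with which [w]
   commutes. *)
have w_iso := normal_isometry w2 (_ : cmul (opstar w) w = _).
have ws : opstar w = - w.
  by apply/skew_of_isometry/w_iso => //; rewrite -{1 4}jz1 -js wC.
pose J : imag_unit (ophil I) :=
  @ImagUnit R (ophil I) (oprep w : {linear ophil I -> ophil I}) (square_rep w2).
have J_iso h k : <<J h, J k>> = <<h, k>> :> R.
  by rewrite /= (@opstarE _ _ I) ws oprepNl square_rep// opprK.
apply: (@complex_opsysP R V I j (ImagUnit zz) (IsometricImagUnit J_iso) j_emb) => v h /=.
  by rewrite zw cmulE.
by rewrite -!cmulE wC.
Qed.

Theorem theorem4p3 (R : realType) (V : ropsys R) (I : rcstar R)
    (j : {linear V -> I}) (envI : injective_envelope j) :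
  (is_complex_opsys V <->
     exists2 z : {linear V -> V}, centralizer j z & forall x, z (z x) = - x) /\
  (is_complex_opsys V <-> cisometric_to_complex_opspace V).
Proof.
(* The implications form the cycle (a), (c), (b), (a). *)
have ac : is_complex_opsys V -> cisometric_to_complex_opspace V.
  move=> [s _ [W [f [f_bij f_emb _]]]]; exists W, f; split=> //.
  exact: order_embedding_isometry f_emb.
have cb := centralizer_of_complex_opspace envI.
have ba : (exists2 z : {linear V -> V}, centralizer j z & forall x, z (z x) = - x) ->
    is_complex_opsys V.
  by move=> [z jz zz]; apply: complex_opsys_of_centralizer envI jz zz.
by split; split; [move=> /ac/cb | exact: ba | exact: ac | move=> /cb/ba].
Qed.
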